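(* Let $\mathcal{C}$ be a small triangulated category with a bounded weight structure $w$. Let $\mathcal{D}_i$, for $i\in\{0,1,2,\dots\}\cup\{+\infty\}$, be full triangulated subcategories of $\mathcal{C}$ such that $w$ restricts to each $\mathcal{D}_i$, $\mathcal{D}_{i+1}\subset\mathcal{D}_i$, $\mathcal{D}_0=\mathcal{C}$, and $\mathcal{D}_{+\infty}=\{0\}$. Let $J\subset\mathbb{Z}\setminus\{0\}$, let $S$ be the class of morphisms $X\stackrel{p\,\mathrm{id}_X}{\longrightarrow}X$ with $p\in J$, $X\in\mathrm{Obj}\,\underline{Hw}$, and let $K$ be the minimal Karoubi-closed full triangulated subcategory of $\mathcal{C}$ containing the cones of all elements of $S$. Let $\mathcal{D}'_i=K\star\mathcal{D}_i$. Let $(a_i)_{i\in\mathbb{Z}}$ be a non-decreasing sequence with values in $\{0,1,2,\dots\}\cup\{+\infty\}$. Denote by $L^{j}:\mathcal{C}\to\mathcal{C}/\mathcal{D}_j$ and $L'^{j}:\mathcal{C}\to\mathcal{C}/\mathcal{D}'_j$ the localization functors. Let $X$ be an object of $\mathcal{C}$ such that $L'^{a_i}(X)\in(\mathcal{C}/\mathcal{D}'_{a_i})_{w\ge -i+1}$ for all $i\in\mathbb{Z}$. 1. Assume that $a_l=0$ for some $l\in\mathbb{Z}$. Then for any integer $N$ there exists a distinguished triangle $T\to X\to M\to T[1]$ such that $T\in\mathrm{Obj}\,K$ and $M$ is an extension of an element $M'\in\mathcal{C}_{w\ge -N+1}$ such that $L^{a_i}(M')\in(\mathcal{C}/\mathcal{D}_{a_i})_{w\ge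 -i+1}$ for any $i\in\mathbb{Z}$, by an element of $(\mathrm{Obj}\,\mathcal{D}_{a_N})\cap\mathcal{C}_{w\le -N}$. 2. For any integers $N$ and $N'$ there exists a distinguished triangle $T\to X\to M\to T[1]$ such that $T\in\mathrm{Obj}\,K$ and $M$ belongs to the class $((\mathrm{Obj}\,\mathcal{D}_{a_N})\cap\mathcal{C}_{w\le -N})\star\{M'\}\star\mathcal{C}_{w\ge -N'}$, where $M'$ is an element of $\mathcal{C}_{w\ge -N+1}$ such that $L^{a_i}(M')\in(\mathcal{C}/\mathcal{D}_{a_i})_{w\ge -i+1}$ for all $i\in\mathbb{Z}$.
   Context: Weight structures. A weight structure $w$ on a triangulated category $\mathcal{C}$ is a pair of classes $\mathcal{C}_{w\le 0},\mathcal{C}_{w\ge 0}\subset \mathrm{Obj}\,\mathcal{C}$ such that: (i) both classes are closed under retracts in $\mathcal{C}$; (ii) $\mathcal{C}_{w\le 0}\subset \mathcal{C}_{w\le 0}[1]$ and $\mathcal{C}_{w\ge 0}[1]\subset \mathcal{C}_{w\ge 0}$; (iii) $\mathcal{C}(X,Y)=0$ for all $X\in\mathcal{C}_{w\le 0}$, $Y\in \mathcal{C}_{w\ge 0}[1]$; (iv) for every object $M$ there is a distinguished triangle $X\to M\to Y\to X[1]$ with $X\in \mathcal{C}_{w\le 0}$, $Y\in\mathcal{C}_{w\ge 0}[1]$. Put $\mathcal{C}_{w\ge i}=\mathcal{C}_{w\ge 0}[i]$, $\mathcal{C}_{w\le i}=\mathcal{C}_{w\le 0}[i]$. The heart $\underline{Hw}$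 is the full subcategory with object class $\mathcal{C}_{w\ge 0}\cap\mathcal{C}_{w\le 0}$. $w$ is bounded if $\bigcup_{i\in\mathbb{Z}}\mathcal{C}_{w\le i}=\mathrm{Obj}\,\mathcal{C}=\bigcup_{i\in\mathbb{Z}}\mathcal{C}_{w\ge i}$. $w$ restricts to a full triangulated subcategory $\mathcal{D}$ if $(\mathrm{Obj}\,\mathcal{D}\cap\mathcal{C}_{w\le 0},\ \mathrm{Obj}\,\mathcal{D}\cap\mathcal{C}_{w\ge 0})$ is a weight structure on $\mathcal{D}$. Extensions. $C$ is an extension of $B$ by $A$ if there is a distinguished triangle $A\to C\to B\to A[1]$. For classes of objects $E,E'$, $E\star E'$ is the class of all extensions of elements of $E'$ by elements of $E$; the operation $\star$ is associative. $K\star\mathcal{D}_i$ denotes the full subcategory with object class $\mathrm{Obj}\,K\star\mathrm{Obj}\,\mathcal{D}_i$; it is a triangulated subcategory of $\mathcal{C}$. A subcategory is Karoubi-closed in $\mathcal{C}$ if it contains all $\mathcal{C}$-retracts of its objects. Weights in localizations. For each of the Verdier quotients $\mathcal{E}=\mathcal{C}/\mathcal{D}_{j}$ and $\mathcal{E}=\mathcal{C}/\mathcal{D}'_{j}$ there is a unique weight structure on $\mathcal{E}$ (again denoted $w$) such that the localization functor sends $\mathcal{C}_{w\le 0}$ into $\mathcal{E}_{w\le 0}$ and $\mathcal{C}_{w\ge 0}$ into $\mathcal{E}_{w\ge 0}$; the classes $\mathcal{E}_{w\le 0}$, $\mathcal{E}_{w\ge 0}$ consist of the retracts in $\mathcal{E}$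 of the images of elements of $\mathcal{C}_{w\le 0}$, $\mathcal{C}_{w\ge 0}$, respectively. *)

(* Defs.v *)
From HB Require Import structures.
From mathcomp Require Import all_boot all_order all_algebra.
From mathcomp Require Import boolp.
Set Implicit Arguments.
Unset Strict Implicit.
Unset Printing Implicit Defensive.
Import GRing.Theory.
Local Open Scope ring_scope.

Declare Scope cat_scope.
Delimit Scope cat_scope with cat.
Local Open Scope cat_scope.

(* The part of a triangulated category that is needed to say what a weight
   structure on it is. Separating it from the triangulated axioms makes the
   definition of weight structures apply, by construction, to full triangulated
   subcategories and to Verdier quotients, which carry such data canonically. *)
Record tridata := TriData {
  obj : Type;
  mor : obj -> obj -> Type;
  idm : forall X, mor X X;
  mcomp : forall X Y Z, mor Y Z -> mor X Y -> mor X Z;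
  zerom : forall X Y, mor X Y;
  tshift : obj -> obj;
  tshiftm : forall X Y, mor X Y -> mor (tshift X) (tshift Y);
  dtriangle : forall X Y Z, mor X Y -> mor Y Z -> mor Z (tshift X) -> Prop;
  compA : forall X Y Z T (h : mor Z T) (g : mor Y Z) (f : mor X Y),
    mcomp h (mcomp g f) = mcomp (mcomp h g) f;
  comp1m : forall X Y (f : mor X Y), mcomp (idm Y) f = f;
  compm1 : forall X Y (f : mor X Y), mcomp f (idm X) = f;
  comp0m : forall X Y Z (f : mor X Y), mcomp (zerom Y Z) f = zerom X Z;
  compm0 : forall X Y Z (g : mor Y Z), mcomp g (zerom X Y) = zerom X Z;
  shiftm1 : forall X, tshiftm (idm X) = idm (tshift X);
  shiftmM : forall X Y Z (g : mor Y Z) (f : mor X Y),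
    tshiftm (mcomp g f) = mcomp (tshiftm g) (tshiftm f);
  shiftm0 : forall X Y, tshiftm (zerom X Y) = zerom (tshift X) (tshift Y)
}.

Arguments mor {t} X Y.
Arguments idm {t} X.
Arguments mcomp {t X Y Z} g f.
Arguments zerom {t} X Y.
Arguments tshift {t} X.
Arguments tshiftm {t X Y} f.
Arguments dtriangle {t X Y Z} f g h.

Notation "g ∘ f" := (mcomp g f) (at level 40, left associativity) : cat_scope.

Section Basics.
Variable T : tridata.
Implicit Types (X Y Z : obj T) (P Q : obj T -> Prop).

Definition is_iso X Y (f : mor X Y) :=
  exists g : mor Y X, g ∘ f = idm X /\ f ∘ g = idm Y.

Definition isomorphic X Y := exists f : mor X Y, is_iso f.

Definition retract_of X Y :=
  exists (i : mor X Y) (r : mor Y X), r ∘ i = idm X.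

Definition retract_closed P := forall X Y, retract_of X Y -> P Y -> P X.

Definition is_zero_obj X := idm X = zerom X X.

(* The class P[n], closed under isomorphism. The shift is only assumed to be
   an autoequivalence, so X is in P[-n] when X[n] is isomorphic to an object
   of P. *)
Definition shifted P (n : int) X :=
  match n with
  | Posz m => exists2 Y, P Y & isomorphic X (iter m tshift Y)
  | Negz m => exists2 Y, P Y & isomorphic (iter m.+1 tshift X) Y
  end.

(* Z is an extension of an element of Q by an element of P. *)
Definition star P Q Z :=
  exists X Y (f : mor X Z) (g : mor Z Y) (h : mor Y (tshift X)),
    [/\ P X, Q Y & dtriangle f g h].

Definition is_weight_structure (le0 ge0 : obj T -> Prop) :=
  [/\ retract_closed le0 /\ retract_closed ge0,
      (forall X, le0 X -> shifted le0 1 X) /\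
        (forall X, shifted ge0 1 X -> ge0 X),
      (forall X Y, le0 X -> shifted ge0 1 Y ->
         forall f : mor X Y, f = zerom X Y) &
      forall M, star le0 (shifted ge0 1) M].

Record weight_structure := WeightStructure {
  wle0 : obj T -> Prop;
  wge0 : obj T -> Prop;
  weightP : is_weight_structure wle0 wge0
}.

Definition wle (w : weight_structure) (i : int) := shifted (wle0 w) i.
Definition wge (w : weight_structure) (i : int) := shifted (wge0 w) i.

Definition heart (w : weight_structure) X := wge0 w X /\ wle0 w X.

Definition wbounded (w : weight_structure) :=
  forall X, (exists i, wle w i X) /\ (exists i, wge w i X).

Record stable := Stable {
  smem :> obj T -> Prop;
  smem_shift : forall X, smem X -> smem (tshift X)
}.

End Basics.

Section FullSubcategory.
Variables (T : tridata) (D : stable T).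

Definition full_obj := {X : obj T | D X}.
Definition full_shift (X : full_obj) : full_obj :=
  exist _ (tshift (sval X)) (smem_shift (svalP X)).

Program Definition full_sub : tridata := {|
  obj := full_obj;
  mor X Y := mor (sval X) (sval Y);
  idm X := idm (sval X);
  mcomp X Y Z g f := g ∘ f;
  zerom X Y := zerom (sval X) (sval Y);
  tshift := full_shift;
  tshiftm X Y f := tshiftm f;
  dtriangle X Y Z f g h := dtriangle f g h
|}.
Next Obligation. exact: compA. Qed.
Next Obligation. exact: comp1m. Qed.
Next Obligation. exact: compm1. Qed.
Next Obligation. exact: comp0m. Qed.
Next Obligation. exact: compm0. Qed.
Next Obligation. exact: shiftm1. Qed.
Next Obligation. exact: shiftmM. Qed.
Next Obligation. exact: shiftm0. Qed.

Definition restricts (w : weight_structure T) :=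
  is_weight_structure (T := full_sub)
    (fun X => wle0 w (sval X)) (fun X => wge0 w (sval X)).

End FullSubcategory.

(* The shift is an additive autoequivalence, not necessarily strictly
   invertible; smallness is obj being a Type and mor having values in Type. *)
Record triangulated := Triangulated {
  tdata :> tridata;
  addm : forall X Y : obj tdata, mor X Y -> mor X Y -> mor X Y;
  oppm : forall X Y : obj tdata, mor X Y -> mor X Y;
  addmA : forall X Y, associative (@addm X Y);
  addmC : forall X Y, commutative (@addm X Y);
  add0m : forall X Y, left_id (zerom X Y) (@addm X Y);
  addNm : forall X Y, left_inverse (zerom X Y) (@oppm X Y) (@addm X Y);
  compDm : forall (X Y Z : obj tdata) (g g' : mor Y Z) (f : mor X Y),
    addm g g' ∘ f = addm (g ∘ f) (g' ∘ f);
  compmD : forall (X Y Z : obj tdata) (g : mor Y Z) (f f' : mor X Y),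
    g ∘ addm f f' = addm (g ∘ f) (g ∘ f');
  zero_obj_ex : exists X : obj tdata, is_zero_obj X;
  biproduct_ex : forall X Y : obj tdata,
    exists B (i : mor X B) (j : mor Y B) (p : mor B X) (q : mor B Y),
      [/\ p ∘ i = idm X, q ∘ j = idm Y, p ∘ j = zerom Y X, q ∘ i = zerom X Y
        & addm (i ∘ p) (j ∘ q) = idm B];
  shiftmD : forall (X Y : obj tdata) (f g : mor X Y),
    tshiftm (addm f g) = addm (tshiftm f) (tshiftm g);
  shift_ff : forall X Y : obj tdata, bijective (fun f : mor X Y => tshiftm f);
  shift_es : forall Y : obj tdata, exists X, isomorphic Y (tshift X);
  tr1_id : forall X Z : obj tdata, is_zero_obj Z ->
    dtriangle (idm X) (zerom X Z) (zerom Z (tshift X));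
  tr1_cone : forall (X Y : obj tdata) (f : mor X Y),
    exists Z (g : mor Y Z) (h : mor Z (tshift X)), dtriangle f g h;
  tr1_iso : forall (X Y Z X' Y' Z' : obj tdata)
      (f : mor X Y) (g : mor Y Z) (h : mor Z (tshift X))
      (f' : mor X' Y') (g' : mor Y' Z') (h' : mor Z' (tshift X'))
      (a : mor X X') (b : mor Y Y') (c : mor Z Z'),
    is_iso a -> is_iso b -> is_iso c ->
    b ∘ f = f' ∘ a -> c ∘ g = g' ∘ b -> tshiftm a ∘ h = h' ∘ c ->
    dtriangle f g h -> dtriangle f' g' h';
  tr2 : forall (X Y Z : obj tdata)
      (f : mor X Y) (g : mor Y Z) (h : mor Z (tshift X)),
    dtriangle f g h <-> dtriangle g h (oppm (tshiftm f));
  tr3 : forall (X Y Z X' Y' Z' : obj tdata)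
      (f : mor X Y) (g : mor Y Z) (h : mor Z (tshift X))
      (f' : mor X' Y') (g' : mor Y' Z') (h' : mor Z' (tshift X'))
      (a : mor X X') (b : mor Y Y'),
    dtriangle f g h -> dtriangle f' g' h' -> b ∘ f = f' ∘ a ->
    exists c : mor Z Z', c ∘ g = g' ∘ b /\ tshiftm a ∘ h = h' ∘ c;
  tr4 : forall (X Y Z A B E : obj tdata) (f : mor X Y) (g : mor Y Z)
      (i : mor Y A) (j : mor A (tshift X))
      (k : mor Z B) (l : mor B (tshift Y))
      (m : mor Z E) (n : mor E (tshift X)),
    dtriangle f i j -> dtriangle g k l -> dtriangle (g ∘ f) m n ->
    exists (u : mor A E) (v : mor E B),
      [/\ dtriangle u v (tshiftm i ∘ l), u ∘ i = m ∘ g, n ∘ u = j, v ∘ m = k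
        & l ∘ v = tshiftm f ∘ n]
}.

HB.instance Definition _ (C : triangulated) (X Y : obj C) :=
  gen_eqMixin (@mor (tdata C) X Y).
HB.instance Definition _ (C : triangulated) (X Y : obj C) :=
  gen_choiceMixin (@mor (tdata C) X Y).
HB.instance Definition _ (C : triangulated) (X Y : obj C) :=
  GRing.isZmodule.Build (@mor (tdata C) X Y)
    (@addmA C X Y) (@addmC C X Y) (@add0m C X Y) (@addNm C X Y).

Section TriangulatedTheory.
Variable C : triangulated.
Implicit Types (X Y Z : obj C) (P : obj C -> Prop).

Lemma compNm X Y Z (g : mor Y Z) (f : mor X Y) : (- g) ∘ f = - (g ∘ f).
Proof.
apply/eqP; rewrite -addr_eq0; apply/eqP.
by rewrite [LHS](esym (compDm _ _ _)) [addm _ _](addNr g) comp0m.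
Qed.

Lemma compmN X Y Z (g : mor Y Z) (f : mor X Y) : g ∘ (- f) = - (g ∘ f).
Proof.
apply/eqP; rewrite -addr_eq0; apply/eqP.
by rewrite [LHS](esym (compmD _ _ _)) [addm _ _](addNr f) compm0.
Qed.

Lemma shiftmN X Y (f : mor X Y) : tshiftm (- f) = - tshiftm f.
Proof.
apply/eqP; rewrite -addr_eq0; apply/eqP.
by rewrite [LHS](esym (shiftmD _ _)) [addm _ _](addNr f) shiftm0.
Qed.

Lemma is_iso_id (T : tridata) (X : obj T) : is_iso (idm X).
Proof. by exists (idm X); rewrite comp1m. Qed.

Lemma dist_shift X Y Z (f : mor X Y) (g : mor Y Z) (h : mor Z (tshift X)) :
  dtriangle f g h -> dtriangle (tshiftm f) (tshiftm g) (- tshiftm h).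
Proof.
move=> /tr2 /tr2 /tr2; rewrite -/(- tshiftm f) -/(- tshiftm g) -/(- tshiftm h).
apply: (tr1_iso (a := idm _) (b := - idm _) (c := idm _)).
- exact: is_iso_id.
- by exists (- idm _); rewrite compNm compmN opprK comp1m.
- exact: is_iso_id.
- by rewrite compNm compmN comp1m compm1 opprK.
- by rewrite compmN compm1 comp1m.
- by rewrite shiftm1 comp1m compm1.
Qed.

(* Subcategories are strict (closed under isomorphism). *)
Definition is_trisub P :=
  [/\ forall X, is_zero_obj X -> P X,
      forall X Y, isomorphic X Y -> P Y -> P X,
      forall X, P X <-> P (tshift X) &
      forall X Y Z (f : mor X Y) (g : mor Y Z) (h : mor Z (tshift X)),
        dtriangle f g h -> P X -> P Y -> P Z].

Definition star_stable (P Q : stable C) : stable C.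
Proof.
refine (@Stable C (star P Q) _) => Z [X [Y [f [g [h [PX QY d]]]]]].
exists (tshift X), (tshift Y), (tshiftm f), (tshiftm g), (- tshiftm h).
by split; [exact: smem_shift | exact: smem_shift | exact: dist_shift].
Defined.

Section Torsion.
Variables (w : weight_structure C) (J : int -> Prop).

Definition torsion_cone Z :=
  exists (p : int) X (g : mor X Z) (h : mor Z (tshift X)),
    [/\ J p, heart w X & dtriangle (idm X *~ p) g h].

(* The minimal Karoubi-closed triangulated subcategory, as an intersection. *)
Definition torsion_mem Z :=
  forall P, is_trisub P -> retract_closed P ->
    (forall Y, torsion_cone Y -> P Y) -> P Z.

Definition torsion : stable C.
Proof.
refine (@Stable C torsion_mem _) => Z KZ P triP retP coneP.
by case: (triP) => _ _ /(_ Z) [+ _] _; apply; apply: KZ.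
Defined.

End Torsion.
End TriangulatedTheory.

(* The Verdier quotient C/D is the localization of C at the class of morphisms
   with a cone in D. Its objects are those of C; its morphisms are the formal
   composites of morphisms of C and of inverses of morphisms in that class,
   modulo the congruence generated by the relations of C and those saying that
   the formal inverses are inverses. *)
Section Verdier.
Variables (C : triangulated) (D : stable C).

Definition cone_in (X Y : obj C) (s : mor X Y) :=
  exists Z (g : mor Y Z) (h : mor Z (tshift X)), D Z /\ dtriangle s g h.

Inductive word : obj C -> obj C -> Type :=
| Wmor X Y (f : mor X Y) : word X Y
| Winv X Y (s : mor X Y) : cone_in s -> word Y X
| Wcomp X Y Z : word Y Z -> word X Y -> word X Z.

Inductive weq : forall X Y, word X Y -> word X Y -> Prop :=
| weq_refl X Y (u : word X Y) : weq u u
| weq_sym X Y (u v : word X Y) : weq u v -> weq v u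
| weq_trans X Y (u v t : word X Y) : weq u v -> weq v t -> weq u t
| weq_comp X Y Z (u u' : word Y Z) (v v' : word X Y) :
    weq u u' -> weq v v' -> weq (Wcomp u v) (Wcomp u' v')
| weq_assoc X Y Z T (u : word Z T) (v : word Y Z) (t : word X Y) :
    weq (Wcomp u (Wcomp v t)) (Wcomp (Wcomp u v) t)
| weq_1m X Y (u : word X Y) : weq (Wcomp (Wmor (idm Y)) u) u
| weq_m1 X Y (u : word X Y) : weq (Wcomp u (Wmor (idm X))) u
| weq_mor X Y Z (g : mor Y Z) (f : mor X Y) :
    weq (Wcomp (Wmor g) (Wmor f)) (Wmor (g ∘ f))
| weq_invl X Y (s : mor X Y) (hs : cone_in s) :
    weq (Wcomp (Winv hs) (Wmor s)) (Wmor (idm X))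
| weq_invr X Y (s : mor X Y) (hs : cone_in s) :
    weq (Wcomp (Wmor s) (Winv hs)) (Wmor (idm Y)).

Section Homs.
Variables X Y : obj C.

Definition weqb (u v : {classic word X Y}) : bool := `[< weq u v >].

Lemma weqb_refl : reflexive weqb.
Proof. by move=> u; apply/asboolP; exact: weq_refl. Qed.

Lemma weqb_sym : symmetric weqb.
Proof. by move=> u v; apply/asboolP/asboolP; exact: weq_sym. Qed.

Lemma weqb_trans : transitive weqb.
Proof.
by move=> v u t /asboolP uv /asboolP vt; apply/asboolP; exact: weq_trans uv vt.
Qed.

Canonical weqb_equiv := EquivRel weqb weqb_refl weqb_sym weqb_trans.

Definition qhom : Type := {eq_quot weqb_equiv}%qT.

Definition qclass (u : word X Y) : qhom := \pi_{eq_quot weqb_equiv}%qT u.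
Definition qword (f : qhom) : word X Y := repr f.

Lemma qwordK f : qclass (qword f) = f.
Proof. exact: reprK. Qed.

Lemma qclassP u v : qclass u = qclass v <-> weq u v.
Proof.
split=> [/eqmodP /asboolP //|uv]; by apply/eqmodP/asboolP.
Qed.

Lemma qword_class u : weq (qword (qclass u)) u.
Proof. by apply/qclassP; rewrite qwordK. Qed.

End Homs.

Lemma cone_in_shift X Y (s : mor X Y) : cone_in s -> cone_in (tshiftm s).
Proof.
move=> [Z [g [h [DZ d]]]]; exists (tshift Z), (tshiftm g), (- tshiftm h).
by split; [exact: smem_shift | exact: dist_shift].
Qed.

Fixpoint wshift X Y (u : word X Y) : word (tshift X) (tshift Y) :=
  match u with
  | Wmor _ _ f => Wmor (tshiftm f)
  | Winv _ _ _ hs => Winv (cone_in_shift hs)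
  | Wcomp _ _ _ u v => Wcomp (wshift u) (wshift v)
  end.

Lemma wshift_weq X Y (u v : word X Y) : weq u v -> weq (wshift u) (wshift v).
Proof.
elim=> {X Y u v} /=.
- by move=> *; exact: weq_refl.
- by move=> X Y u v _; exact: weq_sym.
- by move=> X Y u v t _ uv _; exact: weq_trans.
- by move=> X Y Z u u' v v' _ uu' _; exact: weq_comp.
- by move=> *; exact: weq_assoc.
- by move=> X Y u; rewrite shiftm1; exact: weq_1m.
- by move=> X Y u; rewrite shiftm1; exact: weq_m1.
- by move=> X Y Z g f; rewrite shiftmM; exact: weq_mor.
- by move=> X Y s hs; rewrite shiftm1; exact: weq_invl.
- by move=> X Y s hs; rewrite shiftm1; exact: weq_invr.
Qed.

Definition qmor X Y (f : mor X Y) : qhom X Y := qclass (Wmor f).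
Definition qcomp X Y Z (g : qhom Y Z) (f : qhom X Y) : qhom X Z :=
  qclass (Wcomp (qword g) (qword f)).
Definition qshift X Y (f : qhom X Y) : qhom (tshift X) (tshift Y) :=
  qclass (wshift (qword f)).

Lemma qcompE X Y Z (u : word Y Z) (v : word X Y) :
  qcomp (qclass u) (qclass v) = qclass (Wcomp u v).
Proof. by apply/qclassP/weq_comp; exact: qword_class. Qed.

Lemma qshiftE X Y (u : word X Y) : qshift (qclass u) = qclass (wshift u).
Proof. by apply/qclassP/wshift_weq; exact: qword_class. Qed.

Definition qiso X Y (f : qhom X Y) :=
  exists g : qhom Y X, qcomp g f = qmor (idm X) /\ qcomp f g = qmor (idm Y).

(* The distinguished triangles of C/D are the triangles isomorphic, in C/D, to
   the image of a distinguished triangle of C. *)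
Definition qdist X Y Z (f : qhom X Y) (g : qhom Y Z) (h : qhom Z (tshift X)) :=
  exists X0 Y0 Z0 (f0 : mor X0 Y0) (g0 : mor Y0 Z0) (h0 : mor Z0 (tshift X0))
      (a : qhom X0 X) (b : qhom Y0 Y) (c : qhom Z0 Z),
    [/\ dtriangle f0 g0 h0,
        [/\ qiso a, qiso b & qiso c],
        qcomp b (qmor f0) = qcomp f a,
        qcomp c (qmor g0) = qcomp g b
      & qcomp (qshift a) (qmor h0) = qcomp h c].

Lemma word0m X Y Z (u : word X Y) :
  weq (Wcomp (Wmor (zerom Y Z)) u) (Wmor (zerom X Z)).
Proof.
elim: u Z => {X Y} [X Y f|X Y s hs|X Y T u IHu v IHv] Z.
- by have := weq_mor (zerom Y Z) f; rewrite comp0m.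
- have := weq_comp (weq_mor (zerom Y Z) s) (weq_refl (Winv hs)).
  rewrite comp0m => /weq_sym e; apply: weq_trans e _.
  apply: weq_trans (weq_sym (weq_assoc _ _ _)) _.
  apply: weq_trans (weq_comp (weq_refl _) (weq_invr hs)) _.
  exact: weq_m1.
- apply: weq_trans (weq_assoc _ _ _) _.
  apply: weq_trans (weq_comp (IHu Z) (weq_refl _)) _.
  exact: IHv.
Qed.

Lemma wordm0 X Y Z (u : word Y Z) :
  weq (Wcomp u (Wmor (zerom X Y))) (Wmor (zerom X Z)).
Proof.
elim: u X => {Y Z} [Y Z f|Y Z s hs|Y Z T u IHu v IHv] X.
- by have := weq_mor f (zerom X Y); rewrite compm0.
- have := weq_comp (weq_refl (Winv hs)) (weq_mor s (zerom X Y)).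
  rewrite compm0 => /weq_sym e; apply: weq_trans e _.
  apply: weq_trans (weq_assoc _ _ _) _.
  apply: weq_trans (weq_comp (weq_invl hs) (weq_refl _)) _.
  exact: weq_1m.
- apply: weq_trans (weq_sym (weq_assoc _ _ _)) _.
  apply: weq_trans (weq_comp (weq_refl _) (IHv X)) _.
  exact: IHu.
Qed.

Program Definition verdier : tridata := {|
  obj := obj C;
  mor := qhom;
  idm X := qmor (idm X);
  mcomp := qcomp;
  zerom X Y := qmor (zerom X Y);
  tshift := tshift;
  tshiftm := qshift;
  dtriangle := qdist
|}.
Next Obligation.
rewrite -[h]qwordK -[g]qwordK -[f]qwordK !qcompE.
exact/qclassP/weq_assoc.
Qed.
Next Obligation. by rewrite -[f]qwordK qcompE; exact/qclassP/weq_1m. Qed.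
Next Obligation. by rewrite -[f]qwordK qcompE; exact/qclassP/weq_m1. Qed.
Next Obligation. by rewrite -[f]qwordK qcompE; exact/qclassP/word0m. Qed.
Next Obligation. by rewrite -[g]qwordK qcompE; exact/qclassP/wordm0. Qed.
Next Obligation. by rewrite /qmor qshiftE /= shiftm1. Qed.
Next Obligation. by rewrite -[g]qwordK -[f]qwordK qcompE !qshiftE qcompE. Qed.
Next Obligation. by rewrite /qmor qshiftE /= shiftm0. Qed.

(* The localization functor is the identity on objects and sends a morphism to
   its class; it commutes strictly with the shift. *)
Definition loc (X : obj C) : obj verdier := X.
Definition locm (X Y : obj C) (f : mor X Y) : mor (loc X) (loc Y) := qmor f.

Definition loc_weight_exact (w : weight_structure C)
    (v : weight_structure verdier) :=
  (forall X, wle0 w X -> wle0 v (loc X)) /\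
  (forall X, wge0 w X -> wge0 v (loc X)).

End Verdier.

Arguments loc {C} D X.

(* option nat stands for {0, 1, 2, ...} together with +oo, which is None. *)
Definition leoo (a b : option nat) : Prop :=
  match a, b with
  | _, None => True
  | None, Some _ => False
  | Some m, Some n => (m <= n)%N
  end.

(* Main.v *)
From mathcomp Require Import all_boot all_order all_algebra.
From mathcomp Require Import boolp zify.
Require Import Defs.
Set Implicit Arguments.
Unset Strict Implicit.
Unset Printing Implicit Defensive.
Import Order.TTheory GRing.Theory Num.Theory.
Local Open Scope ring_scope.
Local Open Scope cat_scope.

(* Weights are peeled off X one at a time. If X has weights >= m and L'(X) has
   weights >= m + 1 in C/(K*D), the weight truncation t : A -> X, with A pure of
   weight m, dies in C/(K*D), hence factors through an object of K*D. A product
   q of elements of J kills the part in K, so q t factors through an object of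
   D, which can be truncated to be pure of weight m. This gives
   X in K * D_{w=m} * C_{w>=m+1}. Since objects of K are killed by such products
   and cones of q on pure objects lie in K, one has D*K in K*D, so that the
   layers in K can be collected on the left:
   X in K * (D_{a_{-m}})_{w=m} * ... * (D_{a_{-n}})_{w=n} * C_{w>=n+1}.
   M' is the part of this extension consisting of the weights >= -N+1: for each
   i, its layers of weight <= -i lie in D_{a_i}, and the others have weight
   >= -i+1. *)

(** * Isomorphisms and iterated shifts *)

Section IsoTheory.
Variable T : tridata.
Implicit Types (X Y Z : obj T) (P : obj T -> Prop).

Lemma isomorphic_refl X : isomorphic X X.
Proof. by exists (idm X); exact: is_iso_id. Qed.

Lemma isomorphic_sym X Y : isomorphic X Y -> isomorphic Y X.
Proof. by move=> [f [g [gf fg]]]; exists g, f. Qed.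

Lemma is_iso_comp X Y Z (g : mor Y Z) (f : mor X Y) :
  is_iso g -> is_iso f -> is_iso (g ∘ f).
Proof.
move=> [g' [g'g gg']] [f' [f'f ff']]; exists (f' ∘ g'); split.
- by rewrite -compA (compA g') g'g comp1m.
- by rewrite -compA (compA f) ff' comp1m.
Qed.

Lemma isomorphic_trans Y X Z :
  isomorphic X Y -> isomorphic Y Z -> isomorphic X Z.
Proof. by move=> [f isof] [g isog]; exists (g ∘ f); exact: is_iso_comp. Qed.

Lemma is_iso_shift X Y (f : mor X Y) : is_iso f -> is_iso (tshiftm f).
Proof.
by move=> [g [gf fg]]; exists (tshiftm g); rewrite -!shiftmM gf fg !shiftm1.
Qed.

Lemma isomorphic_shift X Y :
  isomorphic X Y -> isomorphic (tshift X) (tshift Y).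
Proof. by move=> [f isof]; exists (tshiftm f); exact: is_iso_shift. Qed.

Lemma isomorphic_iter n X Y :
  isomorphic X Y -> isomorphic (iter n tshift X) (iter n tshift Y).
Proof. by move=> XY; elim: n => //= n; exact: isomorphic_shift. Qed.

Lemma isomorphic_retract X Y : isomorphic X Y -> retract_of X Y.
Proof. by move=> [f [g [gf _]]]; exists f, g. Qed.

Definition iso_closed P := forall X Y, isomorphic X Y -> P Y -> P X.

Lemma retract_iso_closed P : retract_closed P -> iso_closed P.
Proof. by move=> rP X Y /isomorphic_retract; exact: rP. Qed.

Lemma shifted_iso P n : iso_closed (shifted P n).
Proof.
case: n => n X Y XY [Z PZ YZ]; exists Z => //; apply: isomorphic_trans YZ => //.
exact: (isomorphic_iter n.+1).
Qed.

Fixpoint shiftmn n X Y (f : mor X Y) :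
    mor (iter n tshift X) (iter n tshift Y) :=
  match n with 0%N => f | m.+1 => tshiftm (shiftmn m f) end.

Lemma shiftmn0 n X Y :
  shiftmn n (zerom X Y) = zerom (iter n tshift X) (iter n tshift Y).
Proof. by elim: n => //= n ->; rewrite shiftm0. Qed.

End IsoTheory.

Arguments shiftmn {T} n {X Y} f.

(** * Additivity of composition and full faithfulness of the shift *)

Section Additive.
Variable C : triangulated.
Implicit Types (X Y Z W : obj C).

Lemma compDl X Y Z (g g' : mor Y Z) (f : mor X Y) :
  (g + g') ∘ f = g ∘ f + g' ∘ f.
Proof. exact: compDm. Qed.

Lemma compDr X Y Z (g : mor Y Z) (f f' : mor X Y) :
  g ∘ (f + f') = g ∘ f + g ∘ f'.
Proof. exact: compmD. Qed.

Lemma comp0l X Y Z (f : mor X Y) : (0 : mor Y Z) ∘ f = 0.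
Proof. exact: comp0m. Qed.

Lemma comp0r X Y Z (g : mor Y Z) : g ∘ (0 : mor X Y) = 0.
Proof. exact: compm0. Qed.

Lemma compBl X Y Z (g g' : mor Y Z) (f : mor X Y) :
  (g - g') ∘ f = g ∘ f - g' ∘ f.
Proof. by rewrite compDl compNm. Qed.

Lemma compBr X Y Z (g : mor Y Z) (f f' : mor X Y) :
  g ∘ (f - f') = g ∘ f - g ∘ f'.
Proof. by rewrite compDr compmN. Qed.

Lemma compMzl X Y Z (g : mor Y Z) (f : mor X Y) (n : int) :
  (g *~ n) ∘ f = (g ∘ f) *~ n.
Proof.
have pos (m : nat) : (g *+ m) ∘ f = (g ∘ f) *+ m.
  by elim: m => [|m IH]; rewrite ?mulr0n ?comp0l // !mulrS compDl IH.
case: n => m; first by rewrite -!pmulrn pos.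
by rewrite NegzE !mulrNz -!pmulrn compNm pos.
Qed.

Lemma compMzr X Y Z (g : mor Y Z) (f : mor X Y) (n : int) :
  g ∘ (f *~ n) = (g ∘ f) *~ n.
Proof.
have pos (m : nat) : g ∘ (f *+ m) = (g ∘ f) *+ m.
  by elim: m => [|m IH]; rewrite ?mulr0n ?comp0r // !mulrS compDr IH.
case: n => m; first by rewrite -!pmulrn pos.
by rewrite NegzE !mulrNz -!pmulrn compmN pos.
Qed.

Lemma shiftmZ0 X Y : tshiftm (0 : mor X Y) = 0.
Proof. exact: shiftm0. Qed.

Lemma shiftmMz X Y (f : mor X Y) (n : int) : tshiftm (f *~ n) = tshiftm f *~ n.
Proof.
have pos (m : nat) : tshiftm (f *+ m) = tshiftm f *+ m.
  elim: m => [|m IH]; rewrite ?mulr0n ?shiftmZ0 // !mulrS.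
  by rewrite -IH; exact: shiftmD.
case: n => m; first by rewrite -!pmulrn pos.
by rewrite NegzE !mulrNz -!pmulrn shiftmN pos.
Qed.

Lemma shiftm_inj X Y : injective (fun f : mor X Y => tshiftm f).
Proof. exact: bij_inj (shift_ff X Y). Qed.

Lemma shiftm_full X Y (f : mor (tshift X) (tshift Y)) :
  exists g : mor X Y, tshiftm g = f.
Proof. by have [g _ fK] := shift_ff X Y; exists (g f). Qed.

Lemma is_iso_unshift X Y (f : mor X Y) : is_iso (tshiftm f) -> is_iso f.
Proof.
move=> [g' [gf fg]]; have [g gE] := shiftm_full g'; exists g.
by split; apply: shiftm_inj; rewrite /= shiftmM shiftm1 gE.
Qed.

Lemma isomorphic_unshift X Y :
  isomorphic (tshift X) (tshift Y) -> isomorphic X Y.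
Proof.
by move=> [f' isof]; have [f fE] := shiftm_full f'; exists f;
  apply: is_iso_unshift; rewrite fE.
Qed.

Lemma unshift_ex X : exists Y, isomorphic X (tshift Y).
Proof. exact: shift_es. Qed.

Lemma zero_obj_shift X : is_zero_obj X <-> is_zero_obj (tshift X).
Proof.
split=> [z|z]; first by rewrite /is_zero_obj -shiftm1 z shiftm0.
by apply: shiftm_inj; rewrite /= shiftm1 shiftm0.
Qed.

Lemma zero_obj_from X Y (f : mor X Y) : is_zero_obj X -> f = 0.
Proof. by move=> z; rewrite -[f]compm1 z [LHS]compm0. Qed.

Lemma zero_obj_to X Y (f : mor X Y) : is_zero_obj Y -> f = 0.
Proof. by move=> z; rewrite -[f]comp1m z [LHS]comp0m. Qed.

End Additive.

(** * Distinguished triangles: rotations, weak kernels and cokernels, fibers *)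

Section Triangles.
Variable C : triangulated.
Implicit Types (X Y Z W : obj C).

Lemma rot X Y Z (f : mor X Y) (g : mor Y Z) (h : mor Z (tshift X)) :
  dtriangle f g h -> dtriangle g h (- tshiftm f).
Proof. by move=> /tr2. Qed.

Lemma unrot X Y Z (f : mor X Y) (g : mor Y Z) (h : mor Z (tshift X)) :
  dtriangle g h (- tshiftm f) -> dtriangle f g h.
Proof. by move=> d; apply/tr2. Qed.

(** Three backward rotations turn the goal into the triangle of the negated shifts; [- idm _] on the
    middle object corrects the first two signs. *)
Lemma dist_unshift X Y Z (f : mor X Y) (g : mor Y Z) (h : mor Z (tshift X)) :
  dtriangle (tshiftm f) (tshiftm g) (- tshiftm h) -> dtriangle f g h.
Proof.
move=> d; do 3 apply: unrot.
apply: (tr1_iso (a := idm _) (b := - idm _) (c := idm _)) d.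
- exact: is_iso_id.
- by exists (- idm _); rewrite compNm compmN opprK comp1m.
- exact: is_iso_id.
- by rewrite compNm comp1m compm1.
- by rewrite compmN compNm opprK compm1 comp1m.
- by rewrite shiftm1 comp1m compm1.
Qed.

Lemma dist_id X Z : is_zero_obj Z ->
  dtriangle (idm X) (0 : mor X Z) (0 : mor Z (tshift X)).
Proof. exact: tr1_id. Qed.

Lemma dist_0id Z X : is_zero_obj Z ->
  dtriangle (0 : mor Z X) (idm X) (0 : mor X (tshift Z)).
Proof.
move=> z; apply: unrot; rewrite shiftmZ0 oppr0; apply: dist_id.
exact: (zero_obj_shift Z).1 z.
Qed.

Lemma dist_comp0 X Y Z (f : mor X Y) (g : mor Y Z) (h : mor Z (tshift X)) :
  dtriangle f g h -> g ∘ f = 0.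
Proof.
move=> d; have [O zO] := zero_obj_ex C.
have [c [<- _]] := tr3 (dist_id X zO) d (erefl (f ∘ idm X)).
exact: comp0r.
Qed.

Lemma dist_comp0' X Y Z (f : mor X Y) (g : mor Y Z) (h : mor Z (tshift X)) :
  dtriangle f g h -> h ∘ g = 0.
Proof. by move=> /rot; exact: dist_comp0. Qed.

(** The hypothesis gives a morphism to the triangle 0 -> W = W, whose third component is the
    factorization. *)
Lemma weak_cokernel X Y Z W (f : mor X Y) (g : mor Y Z) (h : mor Z (tshift X))
    (u : mor Y W) : dtriangle f g h -> u ∘ f = 0 -> exists v, u = v ∘ g.
Proof.
move=> d uf0; have [O zO] := zero_obj_ex C.
have [|c [cg _]] := tr3 (a := 0) (b := u) d (dist_0id W zO).
  by rewrite uf0 comp0l.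
by exists c; rewrite cg comp1m.
Qed.

Lemma weak_cokernel' X Y Z W (f : mor X Y) (g : mor Y Z) (h : mor Z (tshift X))
    (u : mor Z W) : dtriangle f g h -> u ∘ g = 0 -> exists v, u = v ∘ h.
Proof. by move=> /rot; exact: weak_cokernel. Qed.

(** Dually, a rotation of W = W -> 0 is mapped to the rotation of the given triangle; the third
    component desuspends to the factorization. *)
Lemma weak_kernel X Y Z W (f : mor X Y) (g : mor Y Z) (h : mor Z (tshift X))
    (u : mor W Y) : dtriangle f g h -> g ∘ u = 0 -> exists v, u = f ∘ v.
Proof.
move=> d gu0; have [O zO] := zero_obj_ex C.
have [|c [_]] := tr3 (a := u) (b := 0) (rot (dist_id W zO)) (rot d).
  by rewrite gu0 comp0l.
have [v <-] := shiftm_full c; rewrite shiftm1 compmN compm1 compNm -shiftmM.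
by move=> /oppr_inj /shiftm_inj ->; exists v.
Qed.

Lemma weak_kernel' X Y Z W (f : mor X Y) (g : mor Y Z) (h : mor Z (tshift X))
    (u : mor W Z) : dtriangle f g h -> h ∘ u = 0 -> exists v, u = g ∘ v.
Proof. by move=> /rot; exact: weak_kernel. Qed.

(** Since the shift is only an equivalence, rotating backwards depends on a chosen desuspension of
    the third object. *)
Lemma unrot_iso X Y Z E (g : mor Y Z) (h : mor Z E) (k : mor E (tshift Y)) :
  dtriangle g h k -> isomorphic E (tshift X) ->
  exists (f : mor X Y) (h' : mor Z (tshift X)), dtriangle f g h'.
Proof.
move=> d [e isoe]; have [e' [e'e ee']] := isoe.
have [f fE] := shiftm_full (- (k ∘ e')).
exists f, (e ∘ h); apply: unrot; rewrite fE opprK.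
apply: (tr1_iso (a := idm _) (b := idm _) (c := e)) d => //.
- exact: is_iso_id.
- exact: is_iso_id.
- by rewrite comp1m compm1.
- by rewrite compm1.
- by rewrite shiftm1 comp1m -compA e'e compm1.
Qed.

Lemma fiber_ex Y Z (g : mor Y Z) :
  exists X (f : mor X Y) (h : mor Z (tshift X)), dtriangle f g h.
Proof.
have [E [h [k d]]] := tr1_cone g; have [X EX] := unshift_ex E.
by have [f [h' d']] := unrot_iso d EX; exists X, f, h'.
Qed.

(** The middle object is a desuspension of the cone of [h]. *)
Lemma connecting_ex Z X (h : mor Z (tshift X)) :
  exists Y (f : mor X Y) (g : mor Y Z), dtriangle f g h.
Proof.
have [U [l [m d]]] := tr1_cone h; have [Y UY] := unshift_ex U.
have [g [k d']] := unrot_iso d UY; have [f fE] := shiftm_full (- k).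
by exists Y, f, g; apply: unrot; rewrite fE opprK.
Qed.

(* The third morphism of a triangle on i vanishes because i splits. *)
Lemma dist_biproduct X Y B (i : mor X B) (j : mor Y B) (p : mor B X)
    (q : mor B Y) :
  p ∘ i = idm X -> q ∘ j = idm Y -> p ∘ j = 0 -> q ∘ i = 0 ->
  i ∘ p + j ∘ q = idm B -> dtriangle i q (0 : mor Y (tshift X)).
Proof.
move=> pi qj pj qi ipjq; have [Z [g [h d]]] := tr1_cone i.
have h0 : h = 0.
  rewrite -[h]comp1m -shiftm1 -pi shiftmM -compA.
  have := dist_comp0' (rot d).
  rewrite compNm => /eqP; rewrite oppr_eq0 => /eqP ->.
  exact: comp0r.
have gi0 := dist_comp0 d.
have [y qE] := weak_cokernel d qi.
have gjq : g ∘ j ∘ q = g.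
  rewrite -[RHS]compm1 -ipjq compDr !compA gi0 comp0l add0r //.
have inv1 : g ∘ j ∘ y = idm Z.
  have : (g ∘ j ∘ y - idm Z) ∘ g = 0.
    by rewrite compBl -compA -qE comp1m gjq subrr.
  case/(weak_cokernel' d) => v; rewrite h0 comp0r => /eqP.
  by rewrite subr_eq0 => /eqP.
have inv2 : y ∘ (g ∘ j) = idm Y by rewrite compA -qE.
apply: (tr1_iso (a := idm X) (b := idm B) (c := y)) d.
- exact: is_iso_id.
- exact: is_iso_id.
- by exists (g ∘ j).
- by rewrite comp1m compm1.
- by rewrite -qE compm1.
- by rewrite h0 comp0r comp0l.
Qed.

End Triangles.

(** * Extensions of classes and associativity of [star] *)

Section Star.
Variable C : triangulated.
Implicit Types (X Y Z W : obj C) (P Q R : obj C -> Prop).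

Lemma star_iso P Q : iso_closed (star P Q).
Proof.
move=> Z Z' [e [e' [e'e ee']]] [X [Y [f [g [h [PX QY d]]]]]].
exists X, Y, (e' ∘ f), (g ∘ e), h; split=> //.
apply: (tr1_iso (a := idm _) (b := e') (c := idm _)) d.
- exact: is_iso_id.
- by exists e.
- exact: is_iso_id.
- by rewrite compm1.
- by rewrite comp1m -compA ee' compm1.
- by rewrite shiftm1 comp1m compm1.
Qed.

Lemma star_sub P P' Q Q' : (forall X, P X -> P' X) -> (forall X, Q X -> Q' X) ->
  forall X, star P Q X -> star P' Q' X.
Proof.
by move=> PP' QQ' Z [X [Y [f [g [h [/PP' ? /QQ' ? d]]]]]]; exists X, Y, f, g, h.
Qed.

Lemma star_shift P P' Q Q' : (forall X, P X -> P' (tshift X)) ->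
  (forall X, Q X -> Q' (tshift X)) ->
  forall X, star P Q X -> star P' Q' (tshift X).
Proof.
move=> PP' QQ' Z [X [Y [f [g [h [/PP' ? /QQ' ? /dist_shift d]]]]]].
by exists (tshift X), (tshift Y), (tshiftm f), (tshiftm g), (- tshiftm h).
Qed.

(** Source and target classes are kept separate so that weight bounds may drop by one under
    desuspension. *)
Lemma star_unshift P P' Q Q' :
  (forall X Y, isomorphic X (tshift Y) -> P X -> P' Y) ->
  (forall X Y, isomorphic X (tshift Y) -> Q X -> Q' Y) ->
  forall X, star P Q (tshift X) -> star P' Q' X.
Proof.
move=> PP' QQ' Z [X [Y [f [g [h [PX QY d]]]]]].
have [X0 [e isoe]] := unshift_ex X; have P'X := PP' _ _ (ex_intro _ e isoe) PX.
have [Y0 [k isok]] := unshift_ex Y; have Q'Y := QQ' _ _ (ex_intro _ k isok) QY.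
have [e' [e'e ee']] := isoe; have [k' [k'k kk']] := isok.
have [f0 f0E] := shiftm_full (f ∘ e').
have [g0 g0E] := shiftm_full (k ∘ g).
have [h0 h0E] := shiftm_full (- (tshiftm e ∘ h ∘ k')).
exists X0, Y0, f0, g0, h0; split=> //; apply: dist_unshift.
rewrite f0E g0E h0E opprK.
apply: (tr1_iso (a := e) (b := idm _) (c := k)) d => //.
- exact: is_iso_id.
- by rewrite comp1m -compA e'e compm1.
- by rewrite compm1.
- by rewrite -[RHS]compA k'k compm1.
Qed.

Lemma star_rot P Q X Y Z (f : mor X Y) (g : mor Y Z) (h : mor Z (tshift X)) :
  dtriangle f g h -> P Y -> Q (tshift X) -> star P Q Z.
Proof. by move=> /rot d PY QX; exists Y, (tshift X), g, h, (- tshiftm f). Qed.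

(** The octahedral axiom for A -> E -> X presents the cone of the composite as an extension of Z by
    B. *)
Lemma star_assocl P Q R X : star (star P Q) R X -> star P (star Q R) X.
Proof.
move=> [E [Z [g [k [l [[A [B [f [i [j [PA QB d1]]]]]] RZ d2]]]]]].
have [U [m [n d3]]] := tr1_cone (g ∘ f).
have [u [v [d4 _ _ _ _]]] := tr4 d1 d2 d3.
exists A, U, (g ∘ f), m, n; split=> //.
by exists B, Z, u, v, (tshiftm i ∘ l).
Qed.

(** The new first term F is the fiber of X -> E -> Z. The octahedral axiom on the rotated triangles
    describes F[1], hence the final desuspension. *)
Lemma star_assocr P Q R X : star P (star Q R) X -> star (star P Q) R X.
Proof.
move=> [A [E [f [g [h [PA [B [Z [f' [g' [h' [QB RZ d2]]]]]] d1]]]]]].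
have [F [m [n d3]]] := fiber_ex (g' ∘ g).
have [u [v [d4 _ _ _ _]]] := tr4 (rot d1) (rot d2) (rot d3).
exists F, Z, m, (g' ∘ g), n; split=> //.
have [u0 u0E] := shiftm_full u; have [v0 v0E] := shiftm_full v.
have [t0 t0E] := shiftm_full (- (tshiftm h ∘ - tshiftm f')).
exists A, B, u0, v0, t0; split=> //; apply: dist_unshift.
by rewrite u0E v0E t0E opprK.
Qed.

End Star.

(** * Triangulated subcategories *)

Section Trisub.
Variables (C : triangulated) (P : obj C -> Prop).
Hypothesis triP : is_trisub P.
Implicit Types (X Y Z W : obj C).

Lemma trisub_zero X : is_zero_obj X -> P X.
Proof. by case: triP => + _ _ _; apply. Qed.

Lemma trisub_iso : iso_closed P.
Proof. by case: triP. Qed.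

Lemma trisub_shift X : P (tshift X) <-> P X.
Proof. by case: triP => _ _ /(_ X) [? ?] _; split. Qed.

Lemma trisub_unshift_iso X Y : isomorphic X (tshift Y) -> P X -> P Y.
Proof.
by move=> /isomorphic_sym XY PX; apply/trisub_shift; exact: trisub_iso PX.
Qed.

Lemma trisub_cone X Y Z (f : mor X Y) (g : mor Y Z) (h : mor Z (tshift X)) :
  dtriangle f g h -> P X -> P Y -> P Z.
Proof. by case: triP => _ _ _; exact. Qed.

(** X[1] is the cone of the connecting map B -> A[1]. *)
Lemma trisub_ext X : star P P X -> P X.
Proof.
move=> [A [B [f [g [h [PA PB /rot /rot d]]]]]]; apply/trisub_shift.
by apply: trisub_cone d _ _ => //; apply/trisub_shift.
Qed.

End Trisub.

(** * Left fractions and the morphisms that vanish in a Verdier quotient *)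

Definition factors (C : triangulated) (P : obj C -> Prop) (X Y : obj C)
    (f : mor X Y) :=
  exists E (u : mor X E) (v : mor E Y), P E /\ f = v ∘ u.

Section Localization.
Variables (C : triangulated) (P : stable C).
Hypothesis triP : is_trisub P.
Implicit Types (X Y Z W : obj C).

Lemma cone_in_id X : cone_in P (idm X).
Proof.
have [O zO] := zero_obj_ex C; exists O, 0, 0; split; last exact: dist_id.
exact: (trisub_zero triP).
Qed.

Lemma cone_in_comp X Y Z (g : mor Y Z) (f : mor X Y) :
  cone_in P g -> cone_in P f -> cone_in P (g ∘ f).
Proof.
move=> [A [g1 [g2 [PA dg]]]] [B [f1 [f2 [PB df]]]].
have [E [k [l d]]] := tr1_cone (g ∘ f).
have [u [v [d' _ _ _ _]]] := tr4 df dg d.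
exists E, k, l; split=> //; apply: (trisub_ext triP).
by exists B, A, u, v, (tshiftm f1 ∘ g2).
Qed.

Lemma cone_in_cancel X Y Z (g : mor Y Z) (f : mor X Y) :
  cone_in P (g ∘ f) -> cone_in P f -> cone_in P g.
Proof.
move=> [A [k [l [PA d]]]] [B [f1 [f2 [PB df]]]].
have [E [g1 [g2 dg]]] := tr1_cone g.
have [u [v [d' _ _ _ _]]] := tr4 df dg d.
by exists E, g1, g2; split=> //; exact: (trisub_cone triP) d' _ _.
Qed.

(** [cone_in] provides one cone in [P]; the octahedral axiom for [idm Y ∘ s] exhibits any other cone
    as an extension of a zero object by it. *)
Lemma cone_in_cone X Y Z (s : mor X Y) (g : mor Y Z) (h : mor Z (tshift X)) :
  cone_in P s -> dtriangle s g h -> P Z.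
Proof.
move=> [Z' [g' [h' [PZ' d']]]]; rewrite -[s in dtriangle s](comp1m s) => d.
have [O zO] := zero_obj_ex C.
have [u [v [dO _ _ _ _]]] := tr4 d' (dist_id Y zO) d.
apply: (trisub_ext triP); exists Z', O, u, v, (tshiftm g' ∘ 0).
by split=> //; exact: (trisub_zero triP).
Qed.

Lemma cone_in_unshift X Y (s : mor X Y) : cone_in P (tshiftm s) -> cone_in P s.
Proof.
move=> [Z [g [h [PZ d]]]]; have [Z0 [e isoe]] := unshift_ex Z.
have [e' [e'e ee']] := isoe; have [g0 g0E] := shiftm_full (e ∘ g).
have [h0 h0E] := shiftm_full (- (h ∘ e')).
exists Z0, g0, h0; split.
  by apply: (trisub_unshift_iso triP) PZ; exists e.
apply: dist_unshift; rewrite g0E h0E opprK.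
apply: (tr1_iso (a := idm _) (b := idm _) (c := e)) d => //.
- exact: is_iso_id.
- exact: is_iso_id.
- by rewrite comp1m compm1.
- by rewrite compm1.
- by rewrite shiftm1 comp1m -compA e'e compm1.
Qed.

Lemma cone_in_iso X Y X' Y' (s : mor X Y) (s' : mor X' Y') (a : mor X X')
    (b : mor Y Y') :
  is_iso a -> is_iso b -> b ∘ s = s' ∘ a -> cone_in P s -> cone_in P s'.
Proof.
move=> isoa [b' [b'b bb']] bs [Z [g [h [PZ d]]]].
exists Z, (g ∘ b'), (tshiftm a ∘ h); split=> //.
apply: (tr1_iso (a := a) (b := b) (c := idm _)) d => //.
- by exists b'.
- exact: is_iso_id.
- by rewrite comp1m -compA b'b compm1.
- by rewrite compm1.
Qed.

(** A homotopy pushout: pushing the connecting map N -> Z[1] along [c] gives a triangle in which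
    [s'] has the same cone N as [s]. *)
Lemma ore_square Z W V (s : mor Z W) (c : mor Z V) : cone_in P s ->
  exists U (s' : mor V U) (c' : mor W U), cone_in P s' /\ c' ∘ s = s' ∘ c.
Proof.
move=> [N [g [h [PN d]]]].
have [U [s' [g' d']]] := connecting_ex (tshiftm c ∘ h).
have [|c1 [+ _]] :=
  tr3 (a := idm N) (b := tshiftm c) (rot (rot d)) (rot (rot d')).
  by rewrite compm1.
have [c' <-] := shiftm_full c1; rewrite compmN compNm -!shiftmM => /oppr_inj.
move=> /shiftm_inj c's; exists U, s', c'; split=> //.
by exists N, g', (tshiftm c ∘ h).
Qed.

(** [f] factors through the cone N of [s] by a map [k]; the map from V to the cone of [k] kills [f]
    and has cone N[1]. *)
Lemma cone_in_kills X Y V (s : mor X Y) (f : mor Y V) : cone_in P s ->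
  f ∘ s = 0 -> exists W (c : mor V W), cone_in P c /\ c ∘ f = 0.
Proof.
move=> [N [g [h [PN d]]]] /(weak_cokernel d) [k ->].
have [W [c [l dk]]] := tr1_cone k; exists W, c; split.
  exists (tshift N), l, (- tshiftm k); split; last exact: rot.
  exact/(trisub_shift triP).
by rewrite compA (dist_comp0 dk) comp0l.
Qed.

Lemma factors_unshift X Y (f : mor X Y) :
  factors P (tshiftm f) -> factors P f.
Proof.
move=> [E [u [v [PE fE]]]]; have [E0 [e isoe]] := unshift_ex E.
have [e' [e'e ee']] := isoe; have [u0 u0E] := shiftm_full (e ∘ u).
have [v0 v0E] := shiftm_full (v ∘ e').
exists E0, u0, v0; split.
  by apply: (trisub_unshift_iso triP) PE; exists e.
apply: shiftm_inj; rewrite /= shiftmM u0E v0E -compA (compA e') e'e comp1m.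
exact: fE.
Qed.

Lemma factors_shiftmn n X Y (f : mor X Y) :
  factors P (shiftmn n f) -> factors P f.
Proof. by elim: n => //= n IH /factors_unshift. Qed.

(* For fixed Z, Hom(Y, Z) in the localization is the set of left fractions
   Y -> Z' <- Z modulo fraceq. A word acts on these sets as a relation, which
   is invariant under weq, so that equal words can be compared in C without
   forming a quotient. *)
Section Fractions.
Variable Z : obj C.

Record frac (Y : obj C) := Frac {
  ftgt : obj C;
  fden : mor Z ftgt;
  fnum : mor Y ftgt;
  fdenP : cone_in P fden
}.

Definition fraceq Y (x y : frac Y) :=
  exists W (a : mor (ftgt x) W) (b : mor (ftgt y) W),
    [/\ cone_in P a, cone_in P b, a ∘ fden x = b ∘ fden y
      & a ∘ fnum x = b ∘ fnum y].

Definition fpull X Y (x : frac Y) (f : mor X Y) : frac X :=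
  Frac (fnum x ∘ f) (fdenP x).

Lemma fraceq_refl Y (x : frac Y) : fraceq x x.
Proof. by exists (ftgt x), (idm _), (idm _); split=> //; exact: cone_in_id. Qed.

Lemma fraceq_sym Y (x y : frac Y) : fraceq x y -> fraceq y x.
Proof. by move=> [W [a [b [? ? ? ?]]]]; exists W, b, a. Qed.

Lemma fraceq_trans Y (y x z : frac Y) : fraceq x y -> fraceq y z -> fraceq x z.
Proof.
move=> [W [a [b [Sa Sb ab1 ab2]]]] [V [c [d [Sc Sd cd1 cd2]]]].
have [U [s [t [Ss ts]]]] := ore_square c Sb.
(* The Ore square controls [s] only; [t] follows by cancelling [b] in [t ∘ b = s ∘ c]. *)
have St : cone_in P t.
  by apply: (cone_in_cancel (f := b)) => //; rewrite ts; exact: cone_in_comp.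
exists U, (t ∘ a), (s ∘ d); split; try exact: cone_in_comp.
- by rewrite -!compA ab1 -cd1 !compA ts.
- by rewrite -!compA ab2 -cd2 !compA ts.
Qed.

Lemma fraceq_pull X Y (x y : frac Y) (f : mor X Y) :
  fraceq x y -> fraceq (fpull x f) (fpull y f).
Proof.
move=> [W [a [b [? ? ? ab]]]]; exists W, a, b.
by split=> //=; rewrite !compA ab.
Qed.

(** With [fpull_inj], this makes precomposition with a denominator bijective on classes of
    fractions, so that its formal inverse can act. *)
Lemma fpull_surj X Y (s : mor X Y) (x : frac X) : cone_in P s ->
  exists y, fraceq x (fpull y s).
Proof.
move=> Ss; have [U [t [c [St cs]]]] := ore_square (fnum x) Ss.
exists (Frac c (cone_in_comp St (fdenP x))), U, t, (idm U).
by split=> //=; rewrite ?comp1m //; exact: cone_in_id.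
Qed.

Lemma fpull_inj X Y (s : mor X Y) (x y : frac Y) : cone_in P s ->
  fraceq (fpull x s) (fpull y s) -> fraceq x y.
Proof.
move=> Ss [W [a [b [Sa Sb /= ab1 ab2]]]].
have [|V [c [Sc c0]]] := cone_in_kills (f := a ∘ fnum x - b ∘ fnum y) Ss.
  by rewrite compBl -!compA ab2 subrr.
exists V, (c ∘ a), (c ∘ b); split; try exact: cone_in_comp.
- by rewrite -!compA ab1.
- by apply/eqP; rewrite -subr_eq0 -!compA -compBr c0.
Qed.

Fixpoint wact X Y (u : word P X Y) : frac Y -> frac X -> Prop :=
  match u with
  | Wmor _ _ f => fun x y => fraceq (fpull x f) y
  | Winv _ _ s _ => fun x y => fraceq x (fpull y s)
  | Wcomp _ _ _ u v => fun x z => exists2 y, wact u x y & wact v y z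
  end.

Lemma wact_eql X Y (u : word P X Y) x x' y :
  fraceq x x' -> wact u x y -> wact u x' y.
Proof.
elim: u x x' y => {X Y} /= [X Y f|X Y s Ss|X Y W u IHu v IHv] x x' y xx'.
- by apply: fraceq_trans; apply/fraceq_sym/fraceq_pull.
- by apply: fraceq_trans; exact: fraceq_sym.
- by move=> [z uz vz]; exists z => //; exact: IHu uz.
Qed.

Lemma wact_eqr X Y (u : word P X Y) x y y' :
  fraceq y y' -> wact u x y -> wact u x y'.
Proof.
elim: u x y y' => {X Y} /= [X Y f|X Y s Ss|X Y W u IHu v IHv] x y y' yy' xy.
- exact: fraceq_trans xy yy'.
- exact: fraceq_trans xy (fraceq_pull s yy').
- by case: xy => z uz vz; exists z => //; exact: IHv vz.
Qed.

Lemma fpull1 Y (x : frac Y) : fraceq (fpull x (idm Y)) x.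
Proof.
exists (ftgt x), (idm _), (idm _); rewrite /= compm1.
by split=> //; exact: cone_in_id.
Qed.

Lemma fpullM X Y W (g : mor Y W) (f : mor X Y) x :
  fraceq (fpull (fpull x g) f) (fpull x (g ∘ f)).
Proof.
exists (ftgt x), (idm _), (idm _); rewrite /= !comp1m compA.
by split=> //; exact: cone_in_id.
Qed.

(** The relations for formal inverses are the substantial cases: [weq_invl] rests on [fpull_surj]
    and [weq_invr] on [fpull_inj]. *)
Lemma wact_weq X Y (u v : word P X Y) :
  weq u v -> forall x y, wact u x y <-> wact v x y.
Proof.
elim=> {X Y u v} /=.
- by [].
- by move=> X Y u v _ IH x y; split=> /IH.
- by move=> X Y u v t _ IH1 _ IH2 x y; rewrite IH1.
- move=> X Y W u u' v v' _ IHu _ IHv x z.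
  by split=> -[y /IHu uy /IHv vy]; exists y.
- move=> X Y V W u v t x y; split.
  + by move=> [z uz [z' vz' tz]]; exists z' => //; exists z.
  + by move=> [z [z' uz' vz] tz]; exists z' => //; exists z.
- move=> X Y u x y; split=> [[z xz uz]|ux].
  2: by exists x => //; exact: fpull1.
  apply: wact_eql uz; apply: fraceq_sym; apply: fraceq_trans xz.
  exact/fraceq_sym/fpull1.
- move=> X Y u x y; split=> [[z uz zy]|ux].
    by apply: wact_eqr uz; apply: fraceq_trans zy; exact/fraceq_sym/fpull1.
  by exists y => //; exact: fpull1.
- move=> X Y W g f x y; split=> [[z xz zy]|xy].
    apply: fraceq_trans (fraceq_sym (fpullM g f x)) _.
    exact: fraceq_trans (fraceq_pull f xz) zy.
  exists (fpull x g); first exact: fraceq_refl.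
  exact: fraceq_trans (fpullM g f x) xy.
- move=> X Y s Ss x y; split=> [[z xz zy]|xy].
    by apply: fraceq_trans (fpull1 _) (fraceq_trans xz zy).
  have [z xz] := fpull_surj x Ss; exists z => //.
  apply: fraceq_trans (fraceq_sym xz) (fraceq_trans _ xy).
  exact/fraceq_sym/fpull1.
- move=> X Y s Ss x y; split=> [[z xz zy]|xy].
    apply: fraceq_trans (fpull1 _) _.
    exact: fpull_inj Ss (fraceq_trans xz zy).
  exists (fpull x s); first exact: fraceq_refl.
  apply: fraceq_pull; apply: fraceq_trans xy.
  exact/fraceq_sym/fpull1.
Qed.

End Fractions.

(** Letting [f] and 0 act on the identity fraction of Y yields a denominator [a] with [a ∘ f = 0];
    then [f] factors through the fiber of [a], which lies in [P]. *)
Lemma locm_eq0 X Y (f : mor X Y) :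
  locm P f = zerom (loc P X) (loc P Y) -> factors P f.
Proof.
move=> /qclassP /wact_weq act.
pose x := Frac (idm Y) (cone_in_id Y).
have [W [b [a [_ Sa /= ab1 ab2]]]] := (act _ x (fpull x f)).1 (fraceq_refl _).
move: ab1 ab2; rewrite !comp1m (compm0 X b) => _ /esym af0.
have [N [g [h [PN d]]]] := Sa.
have [E NE] := unshift_ex N; have [k [l d']] := unrot_iso d NE.
have [v ->] := weak_kernel d' af0.
exists E, v, k; split=> //.
exact: (trisub_unshift_iso triP) NE PN.
Qed.

End Localization.

(** * The localization functor and fullness of the shift on the quotient *)

Section Verdier.
Variables (C : triangulated) (P : stable C).
Implicit Types (X Y Z : obj C).

Lemma locm1 X : locm P (idm X) = idm (loc P X).
Proof. by []. Qed.

Lemma locmM X Y Z (g : mor Y Z) (f : mor X Y) :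
  locm P (g ∘ f) = locm P g ∘ locm P f.
Proof. by rewrite /locm [RHS]qcompE; apply/qclassP/weq_sym/weq_mor. Qed.

Lemma locm_iso X Y (f : mor X Y) : is_iso f -> is_iso (locm P f).
Proof. by move=> [g [gf fg]]; exists (locm P g); rewrite -!locmM gf fg. Qed.

Lemma loc_isomorphic X Y : isomorphic X Y -> isomorphic (loc P X) (loc P Y).
Proof. by move=> [f isof]; exists (locm P f); exact: locm_iso. Qed.

Lemma locm_cone_iso X Y (s : mor X Y) : cone_in P s -> is_iso (locm P s).
Proof.
move=> hs; exists (qclass (Winv hs)); split; rewrite [LHS]qcompE.
- exact/qclassP/weq_invl.
- exact/qclassP/weq_invr.
Qed.

Lemma loc_shifted (Q : obj C -> Prop) (Q' : obj (verdier P) -> Prop) n X :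
  (forall X, Q X -> Q' (loc P X)) -> shifted Q n X -> shifted Q' n (loc P X).
Proof.
move=> QQ'; have iterE m Z : iter m tshift (loc P Z) = loc P (iter m tshift Z).
  by elim: m => //= m ->.
case: n => n [Y QY XY]; exists (loc P Y) => //; try exact: QQ'.
  by rewrite iterE; exact: loc_isomorphic.
by rewrite iterE; exact: loc_isomorphic.
Qed.

Hypothesis triP : is_trisub P.

(** Intermediate objects of a word between shifts need not be shifts themselves. The isomorphisms
    [a] and [b] absorb this, so that the induction can desuspend each letter. *)
Lemma wshift_full X' Y' (u : word P X' Y') X Y (a : mor (tshift X) X')
    (b : mor Y' (tshift Y)) : is_iso a -> is_iso b ->
  exists v : word P X Y, qclass (wshift v) =
    (locm P b ∘ ((qclass u : mor (loc P X') (loc P Y')) ∘ locm P a)).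
Proof.
elim: u X Y a b => {X' Y'} [X' Y' f|X' Y' s hs|
    X' Y' Z' u IHu v IHv] X Y a b isoa isob.
- have [g gE] := shiftm_full (b ∘ (f ∘ a)); exists (Wmor P g).
  by rewrite /= gE -[LHS]/(locm P _) !locmM.
- have [a' [a'a aa']] := isoa; have [b' [b'b bb']] := isob.
  have [t tE] := shiftm_full (a' ∘ (s ∘ b')).
  have ht : cone_in P t.
    apply: (cone_in_unshift triP); rewrite tE.
    apply: (cone_in_iso (a := b) (b := a')) hs => //; first by exists a.
    by rewrite -!compA b'b compm1.
  exists (Winv ht); rewrite [wshift _]/=.
  set I := qclass _ : mor (loc P _) (loc P _).
  have I1 : I ∘ locm P (tshiftm t) = idm _.
    by rewrite [LHS]qcompE; apply/qclassP/weq_invl.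
  have S1 : locm P s ∘ (qclass (Winv hs) : mor (loc P _) (loc P _)) = idm _.
    by rewrite [LHS]qcompE; apply/qclassP/weq_invr.
  rewrite -[RHS]comp1m -I1 tE !locmM -!compA (compA (locm P b')) -locmM b'b.
  rewrite locm1 comp1m (compA (locm P s)) S1 comp1m -locmM a'a locm1 compm1.
  by [].
- have [Y0 [c [c' [c'c cc']]]] := unshift_ex Y'.
  have [u0 u0E] := IHu Y0 Y c' b (ex_intro _ c (conj cc' c'c)) isob.
  have [v0 v0E] := IHv X Y0 a c isoa (ex_intro _ c' (conj c'c cc')).
  exists (Wcomp u0 v0); rewrite [wshift _]/=; rewrite -qcompE u0E v0E.
  pose U : mor (loc P Y') (loc P Z') := qclass u.
  pose V : mor (loc P X') (loc P Y') := qclass v.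
  rewrite -[qclass (Wcomp u v)]qcompE.
  change ((locm P b ∘ (U ∘ locm P c')) ∘ (locm P c ∘ (V ∘ locm P a)) =
    locm P b ∘ ((U ∘ V) ∘ locm P a)).
  by rewrite -!compA (compA (locm P c')) -locmM c'c locm1 comp1m.
Qed.

Lemma verdier_shiftm_full X Y
    (f : mor (tshift (loc P X)) (tshift (loc P Y))) :
  exists g : mor (loc P X) (loc P Y), tshiftm g = f.
Proof.
have [v vE] :=
  wshift_full (qword f) (is_iso_id (tshift X)) (is_iso_id (tshift Y)).
exists (qclass v); rewrite [LHS]qshiftE vE qwordK.
by rewrite locm1 [LHS]comp1m locm1 compm1.
Qed.

Lemma verdier_shiftmn_full n X Y
    (f : mor (iter n tshift (loc P X)) (iter n tshift (loc P Y))) :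
  exists g : mor (loc P X) (loc P Y), shiftmn n g = f.
Proof.
elim: n f => [|n IH] f; first by exists f.
by have [g' <-] := verdier_shiftm_full f; have [g <-] := IH g'; exists g.
Qed.

End Verdier.

(** * Shifted classes over all integers *)

Lemma int_shift_ind (F : int -> Prop) : F 0 ->
  (forall n, F n -> F (n + 1)) -> (forall n, F (n + 1) -> F n) -> forall n, F n.
Proof.
move=> F0 up down; elim/int_rect => [//|n Fn|n Fn].
  by rewrite intS addrC; exact: up.
by apply: down; rewrite intS opprD addrAC addNr add0r.
Qed.

Lemma int_shift_mono (T : Type) (F : int -> T -> Prop) :
  (forall n x, F (n + 1) x -> F n x) ->
  forall m n x, m <= n -> F n x -> F m x.
Proof.
move=> step m n x; rewrite -subr_ge0 => mn; rewrite -[n](subrK m) addrC.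
case: (n - m) mn => // k _; elim: k => [|k IH]; first by rewrite addr0.
by rewrite intS (addrC 1) addrA => /step.
Qed.

Section Shifted.
Variables (C : triangulated) (P : obj C -> Prop).
Hypothesis isoP : iso_closed P.
Implicit Types X Y : obj C.

Lemma shifted0 X : shifted P 0 X <-> P X.
Proof.
split=> [[Y PY XY]|PX]; first exact: isoP PY.
by exists X => //; exact: isomorphic_refl.
Qed.

(** Hides the case distinction on the sign in [shifted]; with [int_shift_ind] it carries facts from
    weight 0 to every weight. *)
Lemma shiftedS n X : shifted P (n + 1) (tshift X) <-> shifted P n X.
Proof.
case: n => [n|[|n]].
- rewrite (_ : Posz n + 1 = Posz n.+1); last by rewrite intS addrC.
  split=> -[Y PY XY]; exists Y => //; first exact: isomorphic_unshift.
  exact: isomorphic_shift.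
- by [].
- rewrite (_ : Negz n.+1 + 1 = Negz n); last by lia.
  by split=> -[Y PY XY]; exists Y => //; move: XY; rewrite -iterSr.
Qed.

Lemma shiftedS_ex n X : shifted P (n + 1) X ->
  exists Y, shifted P n Y /\ isomorphic X (tshift Y).
Proof.
move=> PX; have [Y XY] := unshift_ex X; exists Y; split=> //.
by apply/shiftedS; apply: shifted_iso PX; exact: isomorphic_sym.
Qed.

Lemma shifted_retract n : retract_closed P -> retract_closed (shifted P n).
Proof.
move=> rP; elim/int_shift_ind: n => [|n IH|n IH] X Y [i [r ri]].
- by move=> /shifted0 PY; apply/shifted0; apply: rP PY; exists i, r.
- move=> /shiftedS_ex [Y0 [PY0 [e [e' [e'e ee']]]]].
  have [X0 [k [k' [k'k kk']]]] := unshift_ex X.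
  apply: (shifted_iso (Y := tshift X0)); first by exists k, k'.
  apply/shiftedS; apply: IH PY0.
  have [i0 i0E] := shiftm_full (e ∘ i ∘ k').
  have [r0 r0E] := shiftm_full (k ∘ r ∘ e').
  exists i0, r0; apply: shiftm_inj; rewrite /= shiftmM i0E r0E shiftm1.
  by rewrite -!compA (compA e') e'e comp1m (compA r) ri comp1m.
- move=> /shiftedS PY; apply/shiftedS; apply: IH PY.
  by exists (tshiftm i), (tshiftm r); rewrite -shiftmM ri shiftm1.
Qed.

End Shifted.

(** * Orthogonality, decompositions and extensions in arbitrary weights *)

Section Weights.
Variables (C : triangulated) (w : weight_structure C).
Implicit Types (X Y Z A B M : obj C).

Lemma wle0_iso : iso_closed (wle0 w).
Proof. by apply: retract_iso_closed; case: (weightP w) => -[]. Qed.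

Lemma wge0_iso : iso_closed (wge0 w).
Proof. by apply: retract_iso_closed; case: (weightP w) => -[]. Qed.

Lemma wle_iso n : iso_closed (wle w n).
Proof. exact: shifted_iso. Qed.

Lemma wge_iso n : iso_closed (wge w n).
Proof. exact: shifted_iso. Qed.

Lemma wle_retract n : retract_closed (wle w n).
Proof.
by apply: shifted_retract; [exact: wle0_iso | case: (weightP w) => -[]].
Qed.

Lemma wge_retract n : retract_closed (wge w n).
Proof.
by apply: shifted_retract; [exact: wge0_iso | case: (weightP w) => -[]].
Qed.

Lemma wle_shift n X : wle w (n + 1) (tshift X) <-> wle w n X.
Proof. exact: shiftedS. Qed.

Lemma wge_shift n X : wge w (n + 1) (tshift X) <-> wge w n X.
Proof. exact: shiftedS. Qed.

Lemma wle_unshift n X Y :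
  isomorphic X (tshift Y) -> wle w (n + 1) X -> wle w n Y.
Proof.
by move=> XY wX; apply/wle_shift; apply: wle_iso wX; exact: isomorphic_sym.
Qed.

Lemma wge_unshift n X Y :
  isomorphic X (tshift Y) -> wge w (n + 1) X -> wge w n Y.
Proof.
by move=> XY wX; apply/wge_shift; apply: wge_iso wX; exact: isomorphic_sym.
Qed.

Lemma wleS n X : wle w n X -> wle w (n + 1) X.
Proof.
elim/int_shift_ind: n X => [|n IH|n IH] X.
- move=> /(shifted0 wle0_iso); rewrite add0r.
  by case: (weightP w) => _ [+ _] _ _; apply.
- move=> /shiftedS_ex [Y [wY XY]]; apply: wle_iso XY _; apply/wle_shift.
  exact: IH.
- by move=> wX; apply/wle_shift/IH/wle_shift.
Qed.

Lemma wgeS n X : wge w (n + 1) X -> wge w n X.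
Proof.
elim/int_shift_ind: n X => [|n IH|n IH] X.
- rewrite add0r => wX; apply/(shifted0 wge0_iso).
  by case: (weightP w) => _ [_ +] _ _; apply.
- move=> /shiftedS_ex [Y [wY XY]]; apply: wge_iso XY _; apply/wge_shift.
  exact: IH.
- by move=> wX; apply/wge_shift/IH/wge_shift.
Qed.

Lemma wge_mono m n X : m <= n -> wge w n X -> wge w m X.
Proof. exact: (int_shift_mono wgeS). Qed.

Lemma wle_mono m n X : m <= n -> wle w m X -> wle w n X.
Proof.
move=> mn; rewrite -[n]opprK -[m]opprK.
apply: (int_shift_mono (F := fun k X => wle w (- k) X)); last by rewrite lerN2.
by move=> k Y /wleS; rewrite opprD addrNK.
Qed.

Lemma weight_orth n A B (f : mor A B) : wle w n A -> wge w (n + 1) B -> f = 0.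
Proof.
elim/int_shift_ind: n A B f => [|n IH|n IH] A B f.
- rewrite add0r => /(shifted0 wle0_iso) wA wB.
  by case: (weightP w) => _ _ /(_ A B wA wB f).
- move=> /shiftedS_ex [A0 [wA [e [e' [e'e ee']]]]].
  move=> /shiftedS_ex [B0 [wB [k [k' [k'k kk']]]]].
  have [f0 f0E] := shiftm_full (k ∘ f ∘ e').
  have /(congr1 (fun g => k' ∘ (tshiftm g ∘ e))) := IH _ _ f0 wA wB.
  rewrite f0E shiftmZ0 comp0l comp0r -!compA e'e compm1 compA k'k comp1m.
  by [].
- move=> wA wB; apply: shiftm_inj; rewrite /= shiftmZ0.
  by apply: IH; [apply/wle_shift | apply/wge_shift].
Qed.

(** The class [P] allows one induction to serve both the whole category and a subcategory to which
    [w] restricts. *)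
Lemma weight_dec_in (P : obj C -> Prop) :
  (forall X, P (tshift X) <-> P X) -> iso_closed P ->
  (forall M, P M -> star (fun X => P X /\ wle0 w X)
    (fun X => P X /\ wge w 1 X) M) ->
  forall n M, P M ->
    star (fun X => P X /\ wle w n X) (fun X => P X /\ wge w (n + 1) X) M.
Proof.
move=> shP isoP dec0; elim/int_shift_ind => [|n IH|n IH] M PM.
- apply: star_sub (dec0 M PM) => // X [PX wX]; split=> //.
  by apply/(shifted0 wle0_iso).
- have [M0 MM0] := unshift_ex M; apply: (star_iso MM0).
  have PM0 : P M0 by apply/shP; apply: (isoP _ M) => //; exact: isomorphic_sym.
  apply: star_shift (IH M0 PM0) => X [PX wX].
    by split; [apply/shP | apply/wle_shift].
  by split; [apply/shP | apply/wge_shift].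
- have /IH : P (tshift M) by apply/shP.
  have PY X Y : isomorphic X (tshift Y) -> P X -> P Y.
    by move=> XY PX; apply/shP; apply: (isoP _ X) => //; exact: isomorphic_sym.
  apply: star_unshift => X Y XY [PX wX]; split; try exact: PY PX.
    exact: wle_unshift wX.
  exact: wge_unshift wX.
Qed.

Lemma weight_dec n M : star (wle w n) (wge w (n + 1)) M.
Proof.
suff : star (fun X => True /\ wle w n X) (fun X => True /\ wge w (n + 1) X) M.
  by apply: star_sub => X [].
apply: weight_dec_in => // X _; case: (weightP w) => _ _ _ /(_ X).
by apply: star_sub.
Qed.

Lemma weight_dec_sub (D : stable C) : is_trisub D -> restricts D w ->
  forall n M, D M ->
    star (fun X => D X /\ wle w n X) (fun X => D X /\ wge w (n + 1) X) M.
Proof.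
move=> triD rD; apply: weight_dec_in.
- exact: trisub_shift.
- exact: trisub_iso.
- move=> M DM; case: rD => _ _ _ /(_ (exist _ M DM)).
  move=> [[X DX] [[Y DY] [f [g [h [/= wX [[Z DZ] /= wZ YZ] d]]]]]].
  exists X, Y, f, g, h; split=> //; split=> //; exists Z => //.
Qed.

(** The truncation A -> M vanishes, so the identity of M factors through M -> B and M is a retract
    of B. [wle_orthP] is dual. *)
Lemma wge_orthP n M :
  (forall A (f : mor A M), wle w n A -> f = 0) -> wge w (n + 1) M.
Proof.
move=> orthM; have [A [B [f [g [h [wA wB d]]]]]] := weight_dec n M.
have [|r rg] := weak_cokernel (u := idm M) d.
  by rewrite comp1m; exact: orthM.
by apply: wge_retract wB; exists g, r.
Qed.

Lemma wle_orthP n M :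
  (forall B (f : mor M B), wge w (n + 1) B -> f = 0) -> wle w n M.
Proof.
move=> orthM; have [A [B [f [g [h [wA wB d]]]]]] := weight_dec n M.
have [|i fi] := weak_kernel (u := idm M) d.
  by rewrite compm1; exact: orthM.
by apply: wle_retract wA; exists i, f.
Qed.

Lemma wge_ext n M : star (wge w n) (wge w n) M -> wge w n M.
Proof.
rewrite -[n](subrK 1) => -[A [B [f [g [h [wA wB d]]]]]].
apply: wge_orthP => X k wX; have [|v ->] := weak_kernel (u := k) d.
  exact: weight_orth wX wB.
by rewrite (weight_orth v wX wA) comp0r.
Qed.

Lemma wle_ext n M : star (wle w n) (wle w n) M -> wle w n M.
Proof.
move=> [A [B [f [g [h [wA wB d]]]]]].
apply: wle_orthP => X k wX; have [|v ->] := weak_cokernel (u := k) d.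
  exact: weight_orth wA wX.
by rewrite (weight_orth v wB wX) comp0l.
Qed.

(** X[1] is an extension of Y[1] by Z. *)
Lemma wge_fiber n X Y Z (f : mor X Y) (g : mor Y Z) (h : mor Z (tshift X)) :
  dtriangle f g h -> wge w n Y -> wge w (n + 1) Z -> wge w n X.
Proof.
move=> /rot/rot d wY wZ; apply/wge_shift/wge_ext.
by exists Z, (tshift Y), h, (- tshiftm f), (- tshiftm g); split=> //;
  apply/wge_shift.
Qed.

Lemma wge_cone n X Y Z (f : mor X Y) (g : mor Y Z) (h : mor Z (tshift X)) :
  dtriangle f g h -> wge w n X -> wge w (n + 1) Y -> wge w (n + 1) Z.
Proof.
by move=> d wX wY; apply/wge_ext/(star_rot d) => //; apply/wge_shift.
Qed.

Lemma wle_cone n X Y Z (f : mor X Y) (g : mor Y Z) (h : mor Z (tshift X)) :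
  dtriangle f g h -> wle w n X -> wle w (n + 1) Y -> wle w (n + 1) Z.
Proof.
by move=> d wX wY; apply/wle_ext/(star_rot d) => //; apply/wle_shift.
Qed.

Lemma wge_zero n X : is_zero_obj X -> wge w n X.
Proof.
move=> zX; rewrite -[n](subrK 1); apply: wge_orthP => A f _.
exact: zero_obj_to.
Qed.

Lemma wle_zero n X : is_zero_obj X -> wle w n X.
Proof. by move=> zX; apply: wle_orthP => A f _; exact: zero_obj_from. Qed.

End Weights.

(** * Weights in the quotient and factorization of orthogonal maps *)

Section WeightLocalization.
Variables (C : triangulated) (w : weight_structure C) (P : stable C).
Variable v : weight_structure (verdier P).
Hypothesis wv : loc_weight_exact w v.
Implicit Types (X Y A M : obj C).

Lemma loc_wge n X : wge w n X -> wge v n (loc P X).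
Proof. by apply: loc_shifted; case: wv. Qed.

Lemma loc_wge_cone n X Y (s : mor X Y) :
  cone_in P s -> wge v n (loc P X) <-> wge v n (loc P Y).
Proof.
move=> /locm_cone_iso isos; split; apply: shifted_iso; last by exists (locm P s).
by apply: isomorphic_sym; exists (locm P s).
Qed.

Hypothesis triP : is_trisub P.

(** The image of [f] is zero by orthogonality in the quotient, and [locm_eq0] applies. Orthogonality
    is available in weight 0 only, hence the transport along shifts. *)
Lemma loc_orth_factors n A X (f : mor A X) :
  wle w n A -> wge v (n + 1) (loc P X) -> factors P f.
Proof.
have orth A0 Y (g : mor (loc P A0) (tshift Y)) :
    wle0 w A0 -> wge0 v Y -> g = zerom (loc P A0) (tshift Y).
  move=> wA wY; case: (weightP v) => _ _ orthv _; apply: orthv.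
    by case: wv => + _; exact.
  by exists Y => //; exact: isomorphic_refl.
have loc0 A1 X1 A0 Y (g : mor A1 X1) m : isomorphic A1 (iter m tshift A0) ->
    isomorphic (loc P X1) (iter m tshift (tshift Y)) ->
    wle0 w A0 -> wge0 v Y -> factors P g.
  move=> [e [e' [e'e ee']]] [k [k' [k'k kk']]] wA wY; apply: (locm_eq0 triP).
  pose g' : mor (iter m tshift (loc P A0)) (iter m tshift (tshift Y)) :=
    k ∘ locm P g ∘ locm P e'.
  have g'0 : g' = zerom _ _.
    have [g0 <-] := verdier_shiftmn_full triP g'.
    by rewrite (orth _ _ g0 wA wY); exact: shiftmn0.
  have -> : locm P g = k' ∘ g' ∘ locm P e.
    by rewrite /g' -!compA -locmM e'e locm1 compm1 compA k'k comp1m.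
  by rewrite g'0 [X in X ∘ _]compm0 [LHS]comp0m.
case: n => n [A0 wA Ae].
- rewrite (_ : Posz n + 1 = Posz n.+1); last by rewrite intS addrC.
  by move=> [Y wY XY]; apply: (loc0 _ _ A0 Y f n) => //; rewrite -iterSr.
- rewrite (_ : Negz n + 1 = - n%:Z); last first.
    by rewrite NegzE intS opprD addrAC addNr add0r.
  move=> wX.
  have [Y wY XY] : exists2 Y, wge0 v Y &
      isomorphic (iter n tshift (loc P X)) Y.
    by case: n {Ae} wX => [|n]; rewrite ?oppr0 -?NegzE => -[Y wY XY]; exists Y.
  (* For a negative weight, [f] itself is shifted, until its source becomes isomorphic to the object
     [A0] of weight at most 0. *)
  apply: (factors_shiftmn triP (n := n.+1)).
  apply: (loc0 _ _ A0 Y _ 0%N) => //.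
  exact: isomorphic_shift XY.
Qed.

End WeightLocalization.

(** * Products of elements of [J] and the objects that they kill *)

Inductive monomial (J : int -> Prop) : int -> Prop :=
| monomial1 : monomial J 1
| monomialM p q : J p -> monomial J q -> monomial J (p * q).

Lemma monomial_mul J p q : monomial J p -> monomial J q -> monomial J (p * q).
Proof.
move=> mp mq; elim: mp => [|p' p'' Jp _ IH]; first by rewrite mul1r.
by rewrite -mulrA; exact: monomialM.
Qed.

Lemma monomial_gen J p : J p -> monomial J p.
Proof.
move=> Jp; rewrite -[p]mulr1; apply: monomialM => //; exact: monomial1.
Qed.

Section Scaling.
Variable C : triangulated.
Implicit Types (X Y Z : obj C).

Lemma scale_comp X Y (f : mor X Y) (q : int) : (idm Y *~ q) ∘ f = f *~ q.
Proof. by rewrite compMzl comp1m. Qed.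

Lemma comp_scale X Y (f : mor X Y) (q : int) : f ∘ (idm X *~ q) = f *~ q.
Proof. by rewrite compMzr compm1. Qed.

Lemma scale_shift X (q : int) : tshiftm (idm X *~ q) = idm (tshift X) *~ q.
Proof. by rewrite shiftmMz shiftm1. Qed.

Variable J : int -> Prop.

Definition killed Z := exists2 q, monomial J q & idm Z *~ q = 0.

Lemma killed_retract : retract_closed killed.
Proof.
move=> X Y [i [r ri]] [q mq q0]; exists q => //.
by rewrite -ri -compMzr -scale_comp q0 comp0l comp0r.
Qed.

(* Multiplication by r on the cone Z factors through the connecting morphism
   when r kills Y. *)
Lemma killed_trisub : is_trisub killed.
Proof.
split.
- by move=> X zX; exists 1; [exact: monomial1 | exact: zX].
- exact: retract_iso_closed killed_retract.
- move=> X; split=> -[q mq q0]; exists q => //.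
    by rewrite -scale_shift q0 shiftmZ0.
  by apply: shiftm_inj; rewrite /= scale_shift q0 shiftmZ0.
- move=> X Y Z f g h d [q mq q0] [r mr r0]; exists (r * q).
    exact: monomial_mul.
  have [|v vE] := weak_cokernel' (u := idm Z *~ r) d.
    by rewrite scale_comp -comp_scale r0 comp0r.
  rewrite mulrzA vE -compMzr -scale_comp -scale_shift q0 shiftmZ0.
  by rewrite comp0l comp0r.
Qed.

(** Multiplication by [p] on Z vanishes after [g], so it factors through [h]; as [p] also kills [h],
    its square kills Z. *)
Lemma killed_cone p X Z (g : mor X Z) (h : mor Z (tshift X)) :
  J p -> dtriangle (idm X *~ p) g h -> killed Z.
Proof.
move=> Jp d; exists (p * p); first by apply: monomial_mul; exact: monomial_gen.
have [|v vE] := weak_cokernel' (u := idm Z *~ p) d.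
  by rewrite scale_comp -comp_scale (dist_comp0 d).
rewrite mulrzA vE -compMzr -scale_comp -scale_shift.
have /eqP := dist_comp0 (rot (rot d)); rewrite compNm oppr_eq0 => /eqP ->.
exact: comp0r.
Qed.

End Scaling.

(** * The subcategory [K], its extensions by [D], and peeling off one weight *)

Section Torsion.
Variables (C : triangulated) (w : weight_structure C) (J : int -> Prop).
Let K := torsion w J.
Implicit Types (X Y Z A M : obj C).

Lemma torsion_trisub : is_trisub K.
Proof.
split.
- by move=> X zX Q triQ _ _; exact: trisub_zero.
- by move=> X Y XY KY Q triQ rQ cQ; apply: (trisub_iso triQ XY); exact: KY.
- move=> X; split=> KX Q triQ rQ cQ.
    by apply/(trisub_shift triQ); exact: KX.
  by apply/(trisub_shift triQ); exact: KX.
- move=> X Y Z f g h d KX KY Q triQ rQ cQ.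
  by apply: (trisub_cone triQ d); [exact: KX | exact: KY].
Qed.

(** Minimality of [K]: the killed objects form a Karoubi-closed triangulated subcategory containing
    the generating cones. *)
Lemma torsion_killed Z : K Z -> killed J Z.
Proof.
move=> KZ; apply: KZ; first exact: killed_trisub.
  exact: killed_retract.
by move=> Y [p [X [g [h [Jp _ d]]]]]; exact: killed_cone d.
Qed.

(** The generators cover one element of [J] on an object of the heart; products are reached by
    composing and other weights by shifting. *)
Lemma cone_in_torsion m X q : wge w m X -> wle w m X -> monomial J q ->
  cone_in K (idm X *~ q).
Proof.
move=> geX leX; elim=> [|p r Jp _ IH]; first exact: (cone_in_id torsion_trisub).
rewrite mulrC mulrzA -scale_comp.
apply: (cone_in_comp torsion_trisub) => {r IH} //.
elim/int_shift_ind: m X geX leX => [|n IH|n IH] X.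
- move=> /(shifted0 (@wge0_iso _ w)) geX /(shifted0 (@wle0_iso _ w)) leX.
  have [Z [g [h d]]] := tr1_cone (idm X *~ p).
  exists Z, g, h; split=> // Q _ _; apply.
  by exists p, X, g, h.
- have [Y XY] := unshift_ex X.
  move=> /(wge_unshift XY) geY /(wle_unshift XY) leY.
  have [f [g [gf fg]]] := isomorphic_sym XY.
  apply: (cone_in_iso (a := f) (b := f)) (cone_in_shift (IH Y geY leY)).
  - by exists g.
  - by exists g.
  - by rewrite scale_shift scale_comp comp_scale.
- move=> /wge_shift geX /wle_shift leX; apply: (cone_in_unshift torsion_trisub).
  by rewrite scale_shift; exact: IH.
Qed.

(* Since q kills Z0, the connecting morphism Z0 -> Y[1] factors through
   Cone(q on Y) -> Y[1], and the octahedral axiom swaps the two layers. *)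
Lemma torsion_swap m (E : obj C -> Prop) : iso_closed E ->
  (forall Y, E Y -> wge w m Y /\ wle w m Y) ->
  forall M, star E K M -> star K E M.
Proof.
move=> isoE wE M [Y [Z0 [f [g [h [EY KZ0 d]]]]]].
have [geY leY] := wE Y EY; have [q mq q0] := torsion_killed KZ0.
have [Z [b [z [KZ dz]]]] := cone_in_torsion geY leY mq.
have [|h' hE] := weak_kernel' (u := h) (rot dz).
  by rewrite compNm scale_shift scale_comp -comp_scale q0 comp0r oppr0.
have [T [i [j dT]]] := tr1_cone h'.
have := rot (rot d); rewrite {1}hE => dM.
have [u [v [d' _ _ _ _]]] := tr4 dT (rot (rot dz)) dM.
have KT : K T by exact: (trisub_cone torsion_trisub) dT _ _.
(* Y[1] need not lie in [E]; kept as a singleton class, it gives back Y after desuspension. *)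
have : star K (fun X => X = tshift Y) (tshift M).
  by exists T, (tshift Y), u, v, (tshiftm i ∘ - tshiftm b).
apply: star_unshift => [A B|A B + AE].
  exact: (trisub_unshift_iso torsion_trisub).
by rewrite AE => /isomorphic_unshift /isomorphic_sym BY; exact: isoE EY.
Qed.

Hypothesis w_bounded : wbounded w.
Variable D : stable C.
Hypotheses (triD : is_trisub D) (rD : restricts D w).

Definition pure_in m Y := [/\ D Y, wge w m Y & wle w m Y].

Lemma pure_in_iso m : iso_closed (pure_in m).
Proof.
move=> X Y XY [DY geY leY]; split.
- exact: trisub_iso DY.
- exact: wge_iso geY.
- exact: wle_iso leY.
Qed.

Lemma torsion_swap_pure m M : star (pure_in m) K M -> star K (pure_in m) M.
Proof.
by apply: (torsion_swap (m := m)); [exact: pure_in_iso | move=> Y []].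
Qed.

(** By boundedness, the layer in [D] has finitely many weights; its lowest one is split off and
    swapped with [K] by the pure case. In the induction, [n] bounds the width of the weight
    range. *)
Lemma star_torsion_swap M : star D K M -> star K D M.
Proof.
suff bnd n m Q : star (fun Y => [/\ D Y, wge w m Y & wle w (m + n%:Z) Y]) K Q ->
    star K D Q.
  move=> [Y [Z [f [g [h [DY KZ d]]]]]].
  have [[i leY] [j geY]] := w_bounded Y.
  apply: (bnd `|i - j|%N j); exists Y, Z, f, g, h; split=> //; split=> //.
  by apply: wle_mono leY; lia.
elim: n m Q => [|n IH] m Q.
  rewrite addr0 => /torsion_swap_pure; apply: star_sub => // X [].
  by [].
move=> [Y [Z [f [g [h [[DY geY leY] KZ d]]]]]].
have [A [B [i [p [k [[DA leA] [DB geB] dY]]]]]] :=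
  weight_dec_sub triD rD m DY.
have pA : pure_in m A by split=> //; exact: wge_fiber dY _ _.
have leB : wle w (m + 1 + n%:Z) B.
  rewrite -addrA -[1 + n%:Z]addrC addrA; apply: wle_cone dY _ _.
    by apply: wle_mono leA; lia.
  by apply: wle_mono leY; lia.
have : star (star (pure_in m)
    (fun Y => [/\ D Y, wge w (m + 1) Y & wle w (m + 1 + n%:Z) Y])) K Q.
  by exists Y, Z, f, g, h; split=> //; exists A, B, i, p, k.
move=> /star_assocl H.
have {H} : star (pure_in m) (star K D) Q by apply: star_sub H => // X; exact: IH.
move=> /star_assocr H.
have {H} : star (star K (pure_in m)) D Q.
  by apply: star_sub H => // X; exact: torsion_swap_pure.
move=> /star_assocl; apply: star_sub => // X H; apply: (trisub_ext triD).
by apply: star_sub H => // Y' [].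
Qed.

(** A cone lies in K * D * K * D, and exchanging the two middle factors by [star_torsion_swap]
    leaves K * D. *)
Lemma star_torsion_trisub : is_trisub (star_stable K D).
Proof.
have triK := torsion_trisub; split.
- move=> X zX; exists X, X, (idm X), 0, 0; split; last exact: dist_id.
    exact: (trisub_zero triK).
  exact: (trisub_zero triD).
- exact: star_iso.
- move=> X; split; first exact: smem_shift.
  by apply: star_unshift => A B; exact: trisub_unshift_iso.
- move=> X Y Z f g h d /(smem_shift (s := star_stable K D)) SX SY.
  have := star_rot d SY SX => /star_assocl H.
  have {H} : star K (star (star D K) D) Z.
    by apply: star_sub H => // M; exact: star_assocr.
  move=> H; have {H} : star K (star K (star D D)) Z.
    apply: star_sub H => // M H; apply: star_assocl.
    by apply: star_sub H => // M'; exact: star_torsion_swap.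
  by move=> /star_assocr; apply: star_sub => M; exact: trisub_ext.
Qed.

(** If [q] kills the part of E in [K], then [q] on E factors through the quotient of E in [D]. *)
Lemma factors_star_torsion X Y (f : mor X Y) : factors (star K D) f ->
  exists2 q, monomial J q & factors D (f *~ q).
Proof.
move=> [E [u [v [[T [Y1 [k [e [l [/torsion_killed [q mq q0] DY1 d]]]]]] ->]]]].
exists q => //.
have [|c cE] := weak_cokernel (u := idm E *~ q) d.
  by rewrite scale_comp -comp_scale q0 comp0r.
exists Y1, (e ∘ u), (v ∘ c); split=> //.
by rewrite -compA (compA c) -cE scale_comp compMzr.
Qed.

(** The intermediate object is truncated twice inside [D]: its weights below [m] map to X by zero,
    and its weights above [m] receive only zero from A. *)
Lemma factors_pure m A X (f : mor A X) : wle w m A -> wge w m X ->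
  factors D f -> factors (pure_in m) f.
Proof.
move=> leA geX [E [u [v [DE ->]]]].
have [B [E1 [i [p [k [[_ leB] [DE1 +] d]]]]]] :=
  weight_dec_sub triD rD (m - 1) DE.
rewrite subrK => geE1; have [|v1 ->] := weak_cokernel (u := v) d.
  by apply: weight_orth leB _; rewrite subrK.
have [E2 [B' [i' [p' [k' [[DE2 leE2] [_ geB'] d']]]]]] :=
  weight_dec_sub triD rD m DE1.
have [|u1 uE] := weak_kernel (u := p ∘ u) d'.
  exact: weight_orth leA geB'.
exists E2, u1, (v1 ∘ i'); split; last by rewrite -!compA uE.
by split=> //; exact: wge_fiber d' _ _.
Qed.

Variable v : weight_structure (verdier (star_stable K D)).
Hypothesis wv : loc_weight_exact w v.

(* If t : A -> X is the weight truncation and q t = s r with r : A -> Y,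
   s : Y -> X and Y pure, then (t, -s) factors through the cone Q of
   (q, r) : A -> A + Y. This Q is an extension of Cone(q on A) by Y, and the
   cone of Q -> X has weights >= m + 1. *)
Lemma peel_weight m X : wge w m X -> wge v (m + 1) (loc (star_stable K D) X) ->
  star K (star (pure_in m) (wge w (m + 1))) X.
Proof.
move=> geX locX.
have [A [B [t [b [k [leA geB dt]]]]]] := weight_dec w m X.
have geA : wge w m A by exact: wge_fiber dt _ _.
have [q mq /(factors_pure leA geX)] :=
  factors_star_torsion (loc_orth_factors wv star_torsion_trisub t leA locX).
move=> [Y [r [s [[DY geY leY] tq]]]].
have [U [i [j [p [o [pi oj pj oi ipjo]]]]]] := biproduct_ex A Y.
have {}pj : p ∘ j = 0 := pj; have {}oi : o ∘ i = 0 := oi.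
have dA := dist_biproduct pi oj pj oi ipjo.
have dY : dtriangle j p (0 : mor A (tshift Y)).
  apply: dist_biproduct (oj) (pi) (oi) (pj) _.
  by rewrite addrC; exact: ipjo.
pose phi := i *~ q + j ∘ r; pose psi := t ∘ p - s ∘ o.
have pphi : p ∘ phi = idm A *~ q.
  by rewrite compDr compMzr pi compA pj comp0l addr0.
have psiphi : psi ∘ phi = 0.
  rewrite compBl -!compA pphi comp_scale tq compDr compMzr oi compA oj comp1m.
  by rewrite mul0rz add0r subrr.
have [Q [kap [del dQ]]] := tr1_cone phi.
have [x xE] := weak_cokernel dQ psiphi.
(* The octahedral axiom for Y -> A + Y -> Q identifies the cone E of the composite with a cone of
   [p ∘ phi], that is, of [q] on A. *)
have QE : star (pure_in m) K Q.
  have [E [e1 [e2 dE]]] := tr1_cone (kap ∘ j).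
  have [e3 [e4 [dE' _ _ _ _]]] := tr4 dY (rot dQ) dE.
  have KE : K E.
    apply: (cone_in_cone torsion_trisub (cone_in_torsion geA leA mq)).
    by apply: unrot; rewrite -pphi shiftmM -compmN; exact: dE'.
  by exists Y, E, (kap ∘ j), e1, e2.
(* For A -> A + Y -> Q, the cone E is an extension of A[1] by Y, so it has weights >= m. For A -> Q
   -> X, with composite [t], the cone of Q -> X is then a cone of E -> B. *)
have geQX : star (eq Q) (wge w (m + 1)) X.
  have [V [x1 [x2 dx]]] := tr1_cone x.
  exists Q, V, x, x1, x2; split=> //.
  have [E [e1 [e2 dE]]] := tr1_cone (kap ∘ i).
  have [e3 [e4 [dE' _ _ _ _]]] := tr4 dA (rot dQ) dE.
  have geE : wge w m E.
    apply: wge_ext; exists Y, (tshift A), e3, e4, (tshiftm o ∘ - tshiftm phi).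
    by split=> //; exact/wgeS/wge_shift.
  have tE : x ∘ (kap ∘ i) = t.
    by rewrite compA -xE compBl -!compA pi oi compm1 comp0r subr0.
  have dt' := dt; rewrite -tE in dt'.
  have [e5 [e6 [dV _ _ _ _]]] := tr4 dE dx dt'.
  exact: wge_cone dV _ _.
have : star (star K (pure_in m)) (wge w (m + 1)) X.
  by apply: star_sub geQX => // _ <-; exact: torsion_swap_pure.
exact: star_assocl.
Qed.

End Torsion.

(** * Iterated extensions by layers of consecutive weights *)

Section Chains.
Variables (C : triangulated) (E : int -> obj C -> Prop).
Implicit Types (X Y M : obj C) (P Q R : obj C -> Prop).

(** The class E m * ... * E (m + n - 1) * Q, nested to the right. The tail is a parameter so that
    chains can be cut by [chain_cat]. *)
Fixpoint chain m n Q : obj C -> Prop :=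
  match n with 0%N => Q | n'.+1 => star (E m) (chain (m + 1) n' Q) end.

Lemma chain_sub m n Q Q' : (forall X, Q X -> Q' X) ->
  forall X, chain m n Q X -> chain m n Q' X.
Proof.
move=> QQ'; elim: n m => [|n IH] m X; first exact: QQ'.
by apply: star_sub => // Y; exact: IH.
Qed.

Lemma chain_cat m n1 n2 Q :
  chain m (n1 + n2) Q = chain m n1 (chain (m + n1%:Z) n2 Q).
Proof.
elim: n1 m => [|n1 IH] m; first by rewrite addr0.
by rewrite addSn /= IH -addrA -intS.
Qed.

Lemma chain_starr m n Q R M :
  chain m n (star Q R) M -> star (chain m n Q) R M.
Proof.
elim: n m M => [|n IH] m M //= H; apply: star_assocr.
by apply: star_sub H => // X; exact: IH.
Qed.

(** A zero object inserted before the tail closes the chain, and associativity detaches the tail. *)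
Lemma chain_split m n Q M :
  chain m n Q M -> star (chain m n (@is_zero_obj C)) Q M.
Proof.
move=> H; apply: chain_starr; apply: chain_sub H => X QX.
have [O zO] := zero_obj_ex C.
by exists O, X, 0, (idm X), 0; split=> //; exact: dist_0id.
Qed.

Lemma chain_ext P m n Q : (forall X, star P P X -> P X) ->
  (forall k X, (k < n)%N -> E (m + k%:Z) X -> P X) -> (forall X, Q X -> P X) ->
  forall M, chain m n Q M -> P M.
Proof.
move=> extP; elim: n m => [|n IH] m EP QP M; first exact: QP.
move=> H; apply: extP; apply: star_sub H => X.
  by rewrite -[m]addr0; exact: (EP 0%N).
apply: IH => // k Y kn EY; apply: (EP k.+1) => //.
by rewrite intS addrA.
Qed.

End Chains.

(** * Assembling the layers along the filtration [D] and the sequence [a] *)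

Lemma trisub_leoo (C : triangulated) (D : option nat -> stable C) :
  (forall j, is_trisub (D j)) ->
  (forall (n : nat) X, D (Some n.+1) X -> D (Some n) X) ->
  (forall X, D None X <-> is_zero_obj X) ->
  forall i j X, leoo i j -> D j X -> D i X.
Proof.
move=> triD decr Doo i [n|] X; last by move=> _ /Doo; exact: trisub_zero.
case: i => //= m /subnK <-; elim: (n - m)%N => // k IH.
by rewrite addSn => /decr.
Qed.

Theorem proposition4p2p1
  (C : triangulated) (w : weight_structure C) (w_bounded : wbounded w)
  (D : option nat -> stable C)
  (D_trisub : forall j, is_trisub (D j))
  (D_restricts : forall j, restricts (D j) w)
  (D_decr : forall (n : nat) (X : obj C), D (Some n.+1) X -> D (Some n) X)
  (D_0 : forall X : obj C, D (Some 0%N) X)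
  (D_oo : forall X : obj C, D None X <-> is_zero_obj X)
  (J : int -> Prop) (J_neq0 : ~ J 0)
  (K := torsion w J)
  (D' := fun j => star_stable K (D j))
  (a : int -> option nat)
  (a_ndecr : forall i j : int, i <= j -> leoo (a i) (a j))
  (wD : forall j, weight_structure (verdier (D j)))
  (wD_exact : forall j, loc_weight_exact w (wD j))
  (wD' : forall j, weight_structure (verdier (D' j)))
  (wD'_exact : forall j, loc_weight_exact w (wD' j))
  (X : obj C)
  (X_ge : forall i : int, wge (wD' (a i)) (- i + 1) (loc (D' (a i)) X)) :
  ((exists l : int, a l = Some 0%N) ->
   forall N : int,
   exists (T M : obj C) (f : mor T X) (g : mor X M) (h : mor M (tshift T)),
     [/\ dtriangle f g h, K T &
         exists M' : obj C,
           [/\ wge w (- N + 1) M',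
               forall i : int, wge (wD (a i)) (- i + 1) (loc (D (a i)) M') &
               star (fun A => D (a N) A /\ wle w (- N) A) (fun B => B = M')
                 M]])
  /\
  (forall N N' : int,
   exists (T M : obj C) (f : mor T X) (g : mor X M) (h : mor M (tshift T)),
     [/\ dtriangle f g h, K T &
         exists M' : obj C,
           [/\ wge w (- N + 1) M',
               forall i : int, wge (wD (a i)) (- i + 1) (loc (D (a i)) M') &
               star (fun A => D (a N) A /\ wle w (- N) A)
                 (star (fun B => B = M') (wge w (- N'))) M]]).
Proof.
have Dmono (i j : int) Y : i <= j -> D (a j) Y -> D (a i) Y.
  by move=> /a_ndecr; exact: trisub_leoo.
have [O zO] := zero_obj_ex C.
(* The hypothesis of index i raises weights from -i to -i + 1, so the layer of weight [m] belongs to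
   the index -m. *)
pose E (m : int) := pure_in w (D (a (- m))) m.
have peel (n : nat) (m : int) Y : wge w m Y ->
    (forall i, wge (wD' (a i)) (- i + 1) (loc (D' (a i)) Y)) ->
    star K (chain E m n (wge w (m + n%:Z))) Y.
  elim: n m Y => [|n IH] m Y geY locY.
    exists O, Y, 0, (idm Y), 0; split; last exact: dist_0id.
      exact: trisub_zero (torsion_trisub w J) _ zO.
    by rewrite /= addr0.
  have [|T [M [f [g [h [KT [B [Z [f' [g' [h' [EB geZ d']]]]]] d]]]]]] :=
    peel_weight w_bounded (D_trisub _) (D_restricts _)
      (wD'_exact (a (- m))) geY.
    by have := locY (- m); rewrite opprK.
  (* The remainder Z inherits the hypothesis: for i <= -m, the removed T and B both lie in
     [D' (a i)]; for larger i, the bound already follows from the weights of Z. *)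
  have locZ i : wge (wD' (a i)) (- i + 1) (loc (D' (a i)) Z).
    case: (lerP i (- m)) => im; last first.
      by apply: loc_wge; first exact: wD'_exact; apply: wge_mono geZ; lia.
    have triD' : is_trisub (D' (a i)) by exact: star_torsion_trisub.
    have coneD' U V W (s : mor U V) (x : mor V W) (y : mor W (tshift U)) :
        dtriangle s x y -> D' (a i) U -> cone_in (D' (a i)) x.
      move=> dU DU; exists (tshift U), y, (- tshiftm s); split; last exact: rot.
      exact: smem_shift.
    apply/(loc_wge_cone _ _ (coneD' _ _ _ _ _ _ d' _)).
      exists O, B, 0, (idm B), 0; split; last exact: dist_0id.
        exact: trisub_zero (torsion_trisub w J) _ zO.
      by case: EB => + _ _; exact: Dmono.
    apply/(loc_wge_cone _ _ (coneD' _ _ _ _ _ _ d _)) => //.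
    exists T, O, (idm T), 0, 0; split=> //; last exact: dist_id.
    exact: trisub_zero.
  have : star K (star (E m)
      (star K (chain E (m + 1) n (wge w (m + n.+1%:Z))))) Y.
    exists T, M, f, g, h; split=> //; exists B, Z, f', g', h'; split=> //.
    by have := IH _ _ geZ locZ; rewrite -addrA -intS.
  (* The layers in [K] produced by the induction are moved to the left of the new pure layer, then
     merged with T. *)
  move=> H; have {H} : star K (star K (chain E m n.+1 (wge w (m + n.+1%:Z)))) Y.
    apply: star_sub H => // U /star_assocr H; apply: star_assocl.
    by apply: star_sub H => // V; exact: torsion_swap_pure.
  move=> /star_assocr; apply: star_sub => // U.
  exact: trisub_ext (torsion_trisub w J) _.
have peelN (N : int) (n : nat) :
    star K (star (fun A => D (a N) A /\ wle w (- N) A)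
      (chain E (- N + 1) n (wge w (- N + 1 + n%:Z)))) X.
  have [_ [m geX]] := w_bounded X.
  (* Peeling starts below every weight of X and reaches -N after [n1] layers. These have indices >=
     N, hence lie in [D (a N)], and they merge into one object. *)
  pose n1 := absz (m - (- N + 1))%R.
  have geX' : wge w (- N + 1 - n1%:Z) X by apply: wge_mono geX; rewrite /n1; lia.
  have := peel (n1 + n)%N _ _ geX' X_ge.
  rewrite chain_cat addrNK PoszD addrA addrNK.
  apply: star_sub => // M /chain_split.
  apply: star_sub => // B.
  apply: (chain_ext (P := fun A => D (a N) A /\ wle w (- N) A)).
  - move=> U [A [B' [f [g [h [[DA leA] [DB leB] d]]]]]]; split.
      by apply: (trisub_ext (D_trisub _)); exists A, B', f, g, h.
    by apply: wle_ext; exists A, B', f, g, h.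
  - move=> k U kn1 [DU _ leU]; split; last by apply: wle_mono leU; lia.
    by apply: Dmono DU; lia.
  - by move=> U zU; split; [exact: trisub_zero | exact: wle_zero].
(* A condition in the category itself that implies the required bound in the quotient, where the
   first layer vanishes. *)
pose good (i : int) Y := star (D (a i)) (wge w (- i + 1)) Y.
have goodP i Y : good i Y -> wge (wD (a i)) (- i + 1) (loc (D (a i)) Y).
  move=> [B [Z [f [g [h [DB geZ d]]]]]].
  have cg : cone_in (D (a i)) g.
    exists (tshift B), h, (- tshiftm f).
    by split; [exact: smem_shift | exact: rot].
  by apply/(loc_wge_cone _ _ cg); apply: loc_wge.
have good_wge i Y : wge w (- i + 1) Y -> good i Y.
  move=> geY; exists O, Y, 0, (idm Y), 0; split=> //; last exact: dist_0id.
  exact: trisub_zero.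
have chain_wge (m : int) n Q Y : (forall U, Q U -> wge w m U) ->
    chain E m n Q Y -> wge w m Y.
  move=> Qge; apply: chain_ext => //; first exact: wge_ext.
  by move=> k U _ [_ geU _]; apply: wge_mono geU; lia.
have chain_good (i m : int) n Q Y : (forall U, Q U -> good i U) ->
    (forall U, Q U -> wge w (m + n%:Z) U) -> chain E m n Q Y -> good i Y.
  move=> Qgood; elim: n m Y => [|n IH] m Y Qge; first exact: Qgood.
  (* A first layer of weight m <= -i lies in [D (a i)] and is absorbed; once m > -i, the whole
     remaining chain has weights >= -i + 1. *)
  move=> cY; case: (lerP i (- m)) => im; last first.
    apply: good_wge; apply: (wge_mono (n := m)); first by lia.
    by apply: chain_wge cY => U /Qge; apply: wge_mono; lia.
  have {cY} : star (D (a i)) (good i) Y.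
    apply: star_sub cY => U; first by case=> + _ _; exact: Dmono.
    by apply: IH => V /Qge; rewrite intS addrA.
  move=> /star_assocr; apply: star_sub => // U.
  exact: trisub_ext.
split=> [[l al] N|N N'].
  (* The tail, kept inside M', gets weights >= -l + 1, which is enough for i > l; for i <= l,
     [D (a i)] is everything because [a l] is 0. *)
  pose n := absz (- l + 1 - (- N + 1))%R.
  have [T [M [f [g [h [KT [A [M' [f' [g' [h' [PA cM' d']]]]]] d]]]]]] :=
    peelN N n.
  exists T, M, f, g, h; split=> //; exists M'; split.
  - by apply: chain_wge cM' => U; apply: wge_mono; lia.
  - move=> i; apply: goodP; apply: chain_good cM' => // U geU.
    case: (lerP i l) => il; last by apply: good_wge; apply: wge_mono geU; lia.
    exists U, O, (idm U), 0, 0; split; last exact: dist_id.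
      by apply: (Dmono _ _ _ il); rewrite al.
    exact: wge_zero.
  - by exists A, M', f', g', h'.
(* The tail gets weights >= -N' and is split off; the M' that remains consists of the finitely many
   pure layers. *)
pose n := absz (- N' - (- N + 1))%R.
have [T [M [f [g [h [KT [A [M1 [f' [g' [h' [PA cM1 d']]]]]] d]]]]]] :=
  peelN N n.
have [M' [Y [f1 [g1 [h1 [cM' geY d1]]]]]] := chain_split cM1.
exists T, M, f, g, h; split=> //; exists M'; split.
- by apply: chain_wge cM' => U; exact: wge_zero.
- move=> i; apply: goodP; apply: chain_good cM' => U zU; last exact: wge_zero.
  by apply: good_wge; exact: wge_zero.
- exists A, M1, f', g', h'; split=> //; exists M', Y, f1, g1, h1; split=> //.
  by apply: wge_mono geY; lia.
Qed.
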